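(* (1) There exists a constant $c>0$ such that for all functions $u\in L^1(\mathbb{R})$, $$\big\|\widehat{u}\cdot|\xi|^2\big\|_{L^\infty(\mathbb{R})}^{2}\cdot\big\|u\cdot|x|^{2}\big\|_{L^1(\mathbb{R})}^{2}\;\geq\;c\,\|u\|_{L^1(\mathbb{R})}^{4}.$$ (2) Moreover, $u_0(x)=\max\{1-|x|,0\}$ is a local extremizer in the class of all symmetric $C^3$-functions compactly supported on $[-1,1]$ with nonnegative Fourier transform, in the following sense. For every not identically zero, symmetric (even) function $f:\mathbb{R}\to\mathbb{R}$ of class $C^3$ that is supported in $[-1,1]$ and satisfies $\widehat{f}(\xi)\ge 0$ for all $\xi\in\mathbb{R}$, the functional $$J_f(\varepsilon)=\frac{\big\|\widehat{(u_0+\varepsilon f)}\cdot|\xi|^2\big\|_{L^\infty(\mathbb{R})}^{2}\cdot\big\|(u_0+\varepsilon f)\cdot|x|^{2}\big\|_{L^1(\mathbb{R})}^{2}}{\|u_0+\varepsilon f\|_{L^1(\mathbb{R})}^{4}},$$ considered for small $\varepsilon\ge 0$, has a (right) derivative at $\varepsilon=0$, and $J_f'(0)>0$.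
   Context: The Fourier transform of $f\in L^1(\mathbb{R})$ is $\widehat{f}(\xi)=\int_{\mathbb{R}}f(x)e^{-2\pi i\xi x}\,dx$. The norms on the left-hand side of the inequality in (1) are allowed to equal $+\infty$. *)

(* Defs.v *)
(* MathComp / MathComp-Analysis, with complex numbers R[i] from real-closed. *)
From HB Require Import structures.
From mathcomp Require Import all_boot all_order all_algebra.
From mathcomp Require Import all_classical all_reals all_analysis.
From mathcomp Require Import complex.

Set Implicit Arguments.
Unset Strict Implicit.
Unset Printing Implicit Defensive.

Import Order.TTheory GRing.Theory Num.Theory.
Import numFieldNormedType.Exports.

Local Open Scope classical_set_scope.
Local Open Scope ring_scope.
Local Open Scope complex_scope.

Section Fourier.
Variable R : realType.

Local Notation mu := (@lebesgue_measure R).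

(* The integral of a complex-valued function is taken componentwise, since
   R[i] carries no measurable structure in the library.  It is only
   meaningful when g is in L^1. *)
Definition cintegral (g : R -> R[i]) : R[i] :=
  Rintegral mu setT (fun x => complex.Re (g x))
  +i* Rintegral mu setT (fun x => complex.Im (g x)).

Definition inL1 (u : R -> R[i]) : Prop :=
  mu.-integrable setT (fun x => (complex.Re (u x))%:E) /\
  mu.-integrable setT (fun x => (complex.Im (u x))%:E).

Definition expi (t : R) : R[i] := cos t +i* sin t.

Definition fourier (u : R -> R[i]) (xi : R) : R[i] :=
  cintegral (fun x => u x * expi (- (2 * pi * xi * x))).

(* The L^p norm of |u|; [Lnorm] at p = +oo is the essential supremum. *)
Definition cnorm (p : \bar R) (u : R -> R[i]) : \bar R :=
  'N[mu]_p[(fun x => (ComplexField.Normc.normc (u x))%:E)]%E.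

Definition mulsq (u : R -> R[i]) (x : R) : R[i] := u x * (`|x| ^+ 2)%:C.

(* Convention of \bar R: 0 * +oo = 0; no such product arises for u in L^1,
   as either factor vanishes only when u = 0 almost everywhere. *)
Definition uncertainty (u : R -> R[i]) : \bar R :=
  (cnorm +oo (mulsq (fourier u)) ^+ 2 * cnorm 1 (mulsq u) ^+ 2)%E.

Definition u0 (x : R) : R := Num.max (1 - `|x|) 0.

Definition J (f : R -> R) (eps : R) : \bar R :=
  let u := fun x : R => (u0 x + eps * f x)%:C in
  (uncertainty u / cnorm 1 u ^+ 4)%E.

Definition classC (n : nat) (f : R -> R) : Prop :=
  (forall k : nat, (k < n)%N -> forall x : R, derivable (derive1n k f) x 1) /\
  continuous (derive1n n f).

End Fourier.

(* Main.v *)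
Require Import Defs.
From mathcomp Require Import all_boot all_order all_algebra.
From mathcomp Require Import all_classical all_reals all_analysis.
From mathcomp Require Import complex.
From mathcomp Require Import measurable_realfun ess_sup_inf.
From mathcomp Require Import ring lra.

(** Both halves rest on one explicit Fourier series, that of the second Bernoulli
polynomial: the sum of cos(n pi t) / n^2 over n >= 1 equals
pi^2 (1/6 - t/2 + t^2/4) for 0 <= t <= 2, with an error at most 1/K after K
terms (cos_sum_bern2).  A second difference of it is the cosine series of the
triangle max(d - |t|, 0), again with error 1/K (triangle_series_err).

The inequality.  Write N for the L^1 norm of u, M for the supremum of
|xi|^2 |u^(xi)| and V for the integral of |x|^2 |u(x)|.  A bound of order
S N + M / S on |u| almost everywhere, valid for each S > 0, is what Fourier
inversion gives when the integral of |u^| is cut at |xi| = S.  It is reached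
without an inversion theorem: the triangle series, rescaled to the period 2L,
turns the average of u against a triangle at x into a Riemann sum of values
of u^ at the points n / (2L), which is bounded by N for small n and by M / xi^2
for large n (Rintegral_cos_kernel_le).  Letting L tend to infinity gives the
bound for all triangle averages (Rintegral_tri_le), and the Lebesgue
differentiation theorem carries it to u (tri_bound_ae).  Then N is at most the
mass of u on [-T, T] plus V / T^2 (mass_le), and optimising first S, then T
gives N^2 <= const * M V (mass_le_real).

Local extremality.  On a small segment eps >= 0 the function u0 + eps f is
nonnegative, because f vanishes at the ends of [-1, 1] and has a bounded
derivative (f_le_tri), and its transform is nonnegative.  Hence both L^1 norms
are affine in eps.  The transform of u0 times |xi|^2 is sin(pi xi)^2 / pi^2, which is
maximal exactly at the half-integers, so that the supremum M(eps) is
1 / pi^2 + eps G + O(eps^2), where G is the supremum of |xi|^2 f^(xi) over the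
half-integers (upper_bound, lower_bound).  Differentiating the quotient, the
sign of the derivative is that of pi^2 G plus the integral of f (6 x^2 - 2)
(J_quotient_cvg).

This quantity is the integral of w (6 x^2 - 2) for w = f - pi^2 G u0, as the
integral of u0 (6 x^2 - 2) is -1.  On [-1, 1] the polynomial 6 x^2 - 2 has the
cosine coefficients 24 (-1)^n / (pi n)^2 at n pi, and w was chosen so that
(-1)^n w^(n/2) >= 0 for every n: for even n because u0^ vanishes there and
f^ >= 0, for odd n because of the definition of G (a_ge0).  So the integral is
nonnegative, and if it were zero then every w^(n/2) would vanish.  For odd n
this says that |xi|^2 f^(xi) equals G at all half-integers; as it tends to zero
at infinity, G = 0 and f^(n/2) = 0 for all n >= 1.  The triangle series shows
that f is then constant on (-1, 1) (f_half_mean), hence zero (slope_gt0). *)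

Set Implicit Arguments.
Unset Strict Implicit.
Unset Printing Implicit Defensive.

Import Order.TTheory GRing.Theory Num.Theory.
Import numFieldNormedType.Exports.

Local Open Scope classical_set_scope.
Local Open Scope ring_scope.
Local Open Scope complex_scope.

(** * The cosine series of a parabola and of a triangle *)

Section Series.
Variable R : realType.
Implicit Types (t x : R) (K n : nat).

Lemma is_derive_sum_nat K (F dF : nat -> R -> R) x :
  (forall n, is_derive x 1 (F n) (dF n x)) ->
  is_derive x 1 (fun t => \sum_(n < K) F n t) (\sum_(n < K) dF n x).
Proof.
move=> dFx; elim: K => [|K IH].
  have -> : (fun t => \sum_(n < 0) F n t) = cst 0.
    by apply: funext => t; rewrite big_ord0.
  by rewrite big_ord0; exact: is_derive_cst.
have -> : (fun t => \sum_(n < K.+1) F n t) = (fun t => \sum_(n < K) F n t) + F K.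
  by apply: funext => t; rewrite big_ord_recr.
by rewrite big_ord_recr; exact: is_deriveD.
Qed.

Lemma mean_value_le (f df : R -> R) (a b C : R) : a <= b ->
  (forall x, a <= x <= b -> is_derive x 1 f (df x)) ->
  (forall x, a <= x <= b -> `|df x| <= C) ->
  `|f b - f a| <= C * (b - a).
Proof.
move=> ab dfx dfC.
have [||c cab ->] := @MVT_segment R f df a b ab.
- by move=> x; rewrite in_itv/= => /andP[/ltW ax /ltW xb]; apply: dfx; rewrite ax.
- apply: derivable_within_continuous => x; rewrite in_itv/= => xab.
  by have [] := dfx x xab.
rewrite normrM (@ger0_norm _ (b - a)) ?subr_ge0// ler_wpM2r ?subr_ge0//.
by apply: dfC; move: cab; rewrite in_itv.
Qed.

Definition cos_sum K t : R := \sum_(n < K) cos (n.+1%:R * t) / n.+1%:R ^+ 2.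
Definition sin_sum K t : R := \sum_(n < K) sin (n.+1%:R * t) / n.+1%:R.

Lemma natS_neq0 n : n.+1%:R != 0 :> R. Proof. by rewrite pnatr_eq0. Qed.

Lemma is_derive_cos_sum K x : is_derive x 1 (cos_sum K) (- sin_sum K x).
Proof.
rewrite /sin_sum -sumrN.
apply: (@is_derive_sum_nat K (fun n t => cos (n.+1%:R * t) / n.+1%:R ^+ 2)
  (fun n t => - (sin (n.+1%:R * t) / n.+1%:R))) => n.
apply: is_derive_eq; rewrite /GRing.scale /=; have := natS_neq0 n => n0.
by field.
Qed.

Lemma is_derive_sin_sum K x :
  is_derive x 1 (sin_sum K) (\sum_(n < K) cos (n.+1%:R * x)).
Proof.
apply: (@is_derive_sum_nat K (fun n t => sin (n.+1%:R * t) / n.+1%:R)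
  (fun n t => cos (n.+1%:R * t))) => n.
apply: is_derive_eq; rewrite /GRing.scale /=; have := natS_neq0 n => n0.
by field.
Qed.

Lemma dirichlet_kernel K x :
  2 * sin (x / 2) * (2^-1 + \sum_(n < K) cos (n.+1%:R * x)) =
  sin ((K%:R + 2^-1) * x).
Proof.
elim: K => [|K IH].
  by rewrite big_ord0 addr0 add0r mulrAC divff ?mul1r// mulrC.
rewrite big_ord_recr/= addrA mulrDr IH.
have -> : (K%:R + 2^-1) * x = K.+1%:R * x - x / 2.
  by rewrite -natr1; field.
have -> : (K.+1%:R + 2^-1) * x = K.+1%:R * x + x / 2 by field.
by rewrite sinB sinD; ring.
Qed.

Lemma cos_halfpi_odd K : cos ((K%:R + 2^-1) * pi) = 0 :> R.
Proof.
elim: K => [|K IH]; first by rewrite add0r mulrC cos_pihalf.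
by rewrite -natr1 addrAC mulrDl mul1r cosDpi IH oppr0.
Qed.

Lemma sin_natpi n : sin (n%:R * pi) = 0 :> R.
Proof.
elim: n => [|n IH]; first by rewrite mul0r sin0.
by rewrite -natr1 mulrDl mul1r sinDpi IH oppr0.
Qed.

Lemma sin_half_le (x t : R) : 0 < x -> x <= t <= pi ->
  0 < sin (x / 2) <= sin (t / 2).
Proof.
move=> x0 /andP[xt tpi]; have p0 := @pi_gt0 R.
apply/andP; split; first by apply: sin_gt0_pi; lra.
by rewrite leNgt ltr_sin ?in_itv/= -?leNgt; lra.
Qed.

(** By the Dirichlet kernel, the derivative of the sine sum minus its limit is
sin((K + 1/2) t) / (2 sin(t/2)).  Adding the correction
cos((K + 1/2) t) / ((2K + 1) sin(t/2)) cancels this oscillating term and leaves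
a derivative of size 1/K, while everything vanishes at t = pi; the mean value
inequality concludes. *)
Lemma sin_sum_err K (x t : R) : 0 < x -> x <= t <= pi ->
  `|sin_sum K t - (pi - t) / 2| <= (pi + 1) / (sin (x / 2) ^+ 2 * K.+1%:R).
Proof.
move=> x0 xtpi; have p0 := @pi_gt0 R.
have /andP[xt tpi] := xtpi.
pose A : R := K%:R + 2^-1.
have K0 : 0 <= K%:R :> R by [].
have A0 : 0 < A by rewrite /A; lra.
(* E vanishes at pi, and its derivative dE is of order 1/K away from 0 *)
pose E s := sin_sum K s - (pi - s) / 2 + cos (A * s) * (sin (s / 2))^-1 / (2 * A).
pose dE s := - (cos (A * s) * cos (s / 2) / (sin (s / 2) ^+ 2) / (4 * A)).
have dEE s : x <= s <= pi -> is_derive s 1 E (dE s).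
  move=> /(sin_half_le x0)/andP[sx0 sxs].
  have s0 : sin (s / 2) != 0 by rewrite gt_eqF// (lt_le_trans sx0).
  have d1 := is_derive_sin_sum K s.
  have d2 : is_derive s 1 (fun s : R => (sin (s / 2))^-1)
     (- (sin (s / 2) ^- 2) * (cos (s / 2) / 2)).
    apply: is_deriveV => //.
    by apply: is_derive_eq; rewrite /GRing.scale/=; field.
  apply: is_derive_eq; rewrite /GRing.scale/= /dE.
  have -> : \sum_(n < K) cos (n.+1%:R * s) = sin (A * s) / (2 * sin (s / 2)) - 2^-1.
    by rewrite -dirichlet_kernel; field.
  by field; rewrite s0 gt_eqF.
have sx0 : 0 < sin (x / 2).
  by have /andP[] := sin_half_le x0 xtpi.
pose C := (sin (x / 2) ^+ 2)^-1 / (4 * A).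
have dEC s : x <= s <= pi -> `|dE s| <= C.
  move=> /(sin_half_le x0)/andP[_ sxs].
  have s0 : 0 < sin (s / 2) by rewrite (lt_le_trans sx0).
  rewrite /dE /C normrN normrM (@ger0_norm _ (_ ^-1)) ?invr_ge0; last by lra.
  apply: ler_wpM2r; first by rewrite invr_ge0; lra.
  rewrite normrM (@ger0_norm _ (_ ^-1)) ?invr_ge0 ?sqr_ge0//.
  rewrite -[leRHS]mul1r ler_pM ?invr_ge0 ?sqr_ge0//.
    by rewrite normrM -[leRHS](mulr1 1) ler_pM ?cos_max.
  by rewrite lef_pV2 ?posrE ?exprn_gt0// lerXn2r ?nnegrE// ltW.
have Epi : E pi = 0.
  rewrite /E subrr mul0r subr0 /A cos_halfpi_odd !mul0r addr0 /sin_sum.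
  by apply: big1 => n _; rewrite sin_natpi mul0r.
have : `|E t| <= C * pi.
  have -> : `|E t| = `|E pi - E t| by rewrite Epi sub0r normrN.
  apply: (@le_trans _ _ (C * (pi - t))).
    apply: (@mean_value_le _ dE) => // s /andP[ts spi].
      by apply: dEE; rewrite spi (le_trans xt).
    by apply: dEC; rewrite spi (le_trans xt).
  apply: ler_wpM2l; last by rewrite gerBl (le_trans (ltW x0)).
  by rewrite /C divr_ge0 ?invr_ge0 ?sqr_ge0//; lra.
have sxt : sin (x / 2) <= sin (t / 2) by have /andP[] := sin_half_le x0 xtpi.
have F : `|cos (A * t) * (sin (t / 2))^-1 / (2 * A)| <= (sin (x / 2) ^+ 2)^-1 / (2 * A).
  rewrite normrM (@ger0_norm _ (_ ^-1)) ?invr_ge0; last by lra.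
  apply: ler_wpM2r; first by rewrite invr_ge0; lra.
  rewrite normrM -[leRHS]mul1r ler_pM ?cos_max// ger0_norm ?invr_ge0.
    rewrite lef_pV2 ?posrE ?exprn_gt0 ?(lt_le_trans sx0)//.
    by rewrite (le_trans _ sxt)// expr2 ger_pMl// sin_le1.
  by rewrite ltW// (lt_le_trans sx0).
move=> Et.
have -> : sin_sum K t - (pi - t) / 2 =
  E t - cos (A * t) * (sin (t / 2))^-1 / (2 * A) by rewrite /E; ring.
apply: (le_trans (ler_normB _ _)); apply: (le_trans (lerD Et F)).
have AK : K.+1%:R <= 2 * A by rewrite /A -natr1; lra.
have -> : C * pi + (sin (x / 2) ^+ 2)^-1 / (2 * A) =
  (pi / 2 + 1) * ((sin (x / 2) ^+ 2)^-1 * (2 * A)^-1).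
  by rewrite /C; field; rewrite !gt_eqF.
rewrite [in leRHS]invfM; apply: ler_pM; [by lra| |by lra|].
  by rewrite mulr_ge0 ?invr_ge0 ?sqr_ge0//; lra.
apply: ler_wpM2l; first by rewrite invr_ge0 sqr_ge0.
by rewrite lef_pV2 ?posrE//; lra.
Qed.

(** The candidate sum of cos(n t) / n^2 for 0 <= t <= 2 pi, that is, pi^2 times the
second Bernoulli polynomial at t / (2 pi). *)
Definition bern2 t : R := pi ^+ 2 / 6 - pi * t / 2 + t ^+ 2 / 4.

(** Integrating the sine series identifies the sum up to an additive constant,
namely the error at t = pi. *)
Lemma cos_sum_err K (x : R) : 0 < x <= pi ->
  `|(cos_sum K x - bern2 x) - (cos_sum K pi - bern2 pi)| <=
  (pi + 1) / (sin (x / 2) ^+ 2 * K.+1%:R) * pi.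
Proof.
move=> /andP[x0 xpi]; have p0 := @pi_gt0 R.
pose D s := cos_sum K s - bern2 s.
pose dD s := - (sin_sum K s - (pi - s) / 2).
have dDE (s : R) : is_derive s 1 D (dD s).
  have d1 := is_derive_cos_sum K s.
  by rewrite /D /bern2; apply: is_derive_eq; rewrite /GRing.scale/= /dD; field.
rewrite -normrN opprB -/(D x) -/(D pi).
set C := (_ / (_ * _)); apply: (@le_trans _ _ (C * (pi - x))).
  apply: (@mean_value_le _ dD) => // s /andP[ts spi]//.
  by rewrite /dD normrN sin_sum_err// ts.
apply: ler_wpM2l; last by rewrite gerBl ltW.
rewrite /C divr_ge0//; first by lra.
rewrite ltW// mulr_gt0// exprn_gt0//.
by have /andP[] : 0 < sin (x / 2) <= sin (x / 2) by apply: sin_half_le; rewrite ?lexx.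
Qed.

Lemma cos_sumS K x :
  cos_sum K.+1 x = cos_sum K x + cos (K.+1%:R * x) / K.+1%:R ^+ 2.
Proof. by rewrite /cos_sum big_ord_recr. Qed.

(** In cos(n x) + cos(n (x + pi)) the odd terms cancel and the even ones double.
Comparing this with the same identity for the limit determines the constant
left open by cos_sum_err. *)
Lemma cos_sum_double K x :
  cos_sum K.*2 x + cos_sum K.*2 (x + pi) = cos_sum K (2 * x) / 2.
Proof.
elim: K => [|K IH]; first by rewrite /cos_sum !big_ord0 mul0r addr0.
rewrite doubleS !cos_sumS.
have cosD2npi n (y : R) : cos (y + n.*2%:R * pi) = cos y.
  have -> : n.*2%:R * pi = pi *+ 2 *+ n :> R by rewrite -mulrnA mul2n mulr_natl.
  exact: (periodicn (@cosD2pi R)).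
have -> : (K.*2.+1)%:R * (x + pi) = (K.*2.+1)%:R * x + pi + K.*2%:R * pi.
  by rewrite -natr1; ring.
have -> : (K.*2.+2)%:R * (x + pi) = (K.*2.+2)%:R * x + (K.+1).*2%:R * pi.
  by rewrite doubleS; ring.
rewrite !cosD2npi cosDpi [RHS]mulrDl -IH.
have -> : K.+1%:R * (2 * x) = K.*2.+2%:R * x.
  by rewrite -doubleS -mul2n natrM; ring.
have -> : K.*2.+2%:R = 2 * K.+1%:R :> R by rewrite -doubleS -mul2n natrM.
have := natS_neq0 K => n0; have := natS_neq0 K.*2 => n1.
by move: (K.+1%:R : R) (K.*2.+1%:R : R) n0 n1 => a b a0 b0; field; rewrite a0 b0.
Qed.

(** Telescoping: 1/(n+1)^2 <= 1/n - 1/(n+1). *)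
Lemma cos_sum_tail K M x : (0 < K)%N -> (K <= M)%N ->
  `|cos_sum M x - cos_sum K x| <= K%:R^-1 - M%:R^-1.
Proof.
move=> K0 /subnK <-; elim: (M - K)%N => [|m IH].
  by rewrite add0n !subrr normr0.
rewrite addSn cos_sumS addrAC.
apply: (le_trans (ler_normD _ _)); set N := (m + K)%N.
have N0 : 0 < N%:R :> R by rewrite ltr0n addn_gt0 K0 orbT.
have H : `|cos (N.+1%:R * x) / N.+1%:R ^+ 2| <= N%:R^-1 - N.+1%:R^-1.
  rewrite normrM (@ger0_norm _ (_ ^-1)) ?invr_ge0 ?exprn_ge0//.
  apply: (@le_trans _ _ (N.+1%:R^-1 / N%:R)).
    rewrite -invfM -[leRHS]mul1r ler_pM ?invr_ge0 ?exprn_ge0 ?cos_max//.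
    rewrite lef_pV2 ?posrE ?mulr_gt0 ?exprn_gt0//.
    by rewrite expr2 ler_wpM2l// ler_nat.
  rewrite -natr1; move: (N%:R : R) N0 => b b0.
  rewrite le_eqVlt; apply/orP; left; apply/eqP; field.
  have b1 : 0 < b + 1 by rewrite addr_gt0.
  by rewrite !lt0r_neq0.
by apply: (le_trans (lerD IH H)); rewrite -/N addrA subrK.
Qed.

Lemma ler_add_invn (y z c : R) :
  (forall M, (0 < M)%N -> y <= z + c / M%:R) -> y <= z.
Proof.
move=> H; apply/ler_addgt0Pr => e e0.
have [c0|c0] := lerP c 0.
  by have := H 1%N isT; rewrite divr1; lra.
have := archi_boundP (ltW (divr_gt0 c0 e0)); set M := Num.bound _ => cM.
have M0 : 0 < M%:R :> R by rewrite (le_lt_trans _ cM)// divr_ge0// ltW.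
apply: (le_trans (H M _)); first by rewrite -(ltr0n R).
by rewrite lerD2l ler_pdivrMr// mulrC -ler_pdivrMr// ltW.
Qed.

Let a K x := cos_sum K x - bern2 x.

(** The duplication identity at pi/2, where both terms agree, reads
4 e(pi/2) = e(pi) for the error e up to O(1/K), whereas cos_sum_err says
e(pi/2) = e(pi) up to O(1/K); so e(pi) = O(1/K). *)
Lemma cos_sum_bigO_pi : exists c, forall K, (0 < K)%N -> `|a K pi| <= c / K%:R.
Proof.
have p0 := @pi_gt0 R.
pose d : R := (pi + 1) / (sin (pi / 2 / 2) ^+ 2) * pi.
have ph : 0 < (pi / 2 : R) <= pi by apply/andP; split; lra.
have s0 : 0 < sin (pi / 2 / 2 : R).
  by apply: sin_gt0_pi; lra.
have d0 : 0 <= d by rewrite /d mulr_ge0 ?divr_ge0 ?exprn_ge0//; lra.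
exists (2 * d + 2) => K K0.
have K0' : 0 < K%:R :> R by rewrite ltr0n.
have h1 : `|a K.*2 (pi / 2) - a K.*2 pi| <= d / K%:R.
  apply: (le_trans (cos_sum_err K.*2 ph)).
  rewrite /d invfM mulrA mulrAC; apply: ler_wpM2l => //.
  by rewrite lef_pV2 ?posrE// ler_nat -addnn -addnS leq_addr.
have h2 : `|a K.*2 pi - a K pi| <= K%:R^-1.
  have KK : (K <= K.*2)%N by rewrite -addnn leq_addr.
  have := cos_sum_tail pi K0 KK.
  have -> : cos_sum K.*2 pi - cos_sum K pi = a K.*2 pi - a K pi by rewrite /a; ring.
  by move=> /le_trans; apply; rewrite gerBl invr_ge0.
have sym : cos_sum K.*2 (pi / 2 + pi) = cos_sum K.*2 (pi / 2).
  apply: eq_bigr => n _; congr (_ / _).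
  have -> : n.+1%:R * (pi / 2 + pi) = - (n.+1%:R * (pi / 2)) + pi *+ 2 *+ n.+1 :> R.
    by rewrite -(mulr_natl (pi *+ 2)) -(mulr_natl pi 2); field.
  by rewrite (periodicn (@cosD2pi R)) cosN.
have := cos_sum_double K (pi / 2); rewrite sym.
have -> : 2 * (pi / 2) = pi :> R by field.
have E1 : cos_sum K.*2 (pi / 2) = a K.*2 (pi / 2) - pi ^+ 2 / 48.
  by rewrite /a /bern2; field.
have E2 : cos_sum K pi = a K pi - pi ^+ 2 / 12 by rewrite /a /bern2; field.
rewrite E1 E2 => E.
have {}E : 4 * a K.*2 (pi / 2) = a K pi by lra.
have -> : (2 * d + 2) / K%:R = 2 * (d / K%:R) + 2 * K%:R^-1 by ring.
rewrite -E in h2 *.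
move: h1 h2 (divr_ge0 d0 (ltW K0')).
move: (d / K%:R) (K%:R^-1) (a K.*2 (pi / 2)) (a K.*2 pi) => u v z w.
by rewrite !ler_norml => /andP[h1 h2] /andP[h3 h4] u0; apply/andP; split; lra.
Qed.

(** At x = 0, out of reach of cos_sum_err, the duplication identity
e(0) + e(pi) = e(0) / 2 is used instead. *)
Lemma cos_sum_bigO (x : R) : 0 <= x <= pi ->
  exists c, forall K, (0 < K)%N -> `|a K x| <= c / K%:R.
Proof.
move=> /andP[x0 xpi]; have [c hc] := cos_sum_bigO_pi.
move: x0; rewrite le_eqVlt => /predU1P[<-|x0].
  exists (c + 2) => K K0; have K0' : 0 < K%:R :> R by rewrite ltr0n.
  have KK : (K <= K.*2)%N by rewrite -addnn leq_addr.
  have h1 := cos_sum_tail 0 K0 KK.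
  have K20 : (0 < K.*2)%N by rewrite double_gt0.
  have h2 := hc _ K20.
  have := cos_sum_double K 0; rewrite add0r mulr0 => E.
  move: h1 h2; rewrite /a.
  have -> : bern2 0 = pi ^+ 2 / 6 by rewrite /bern2; field.
  have -> : bern2 pi = - pi ^+ 2 / 12 by rewrite /bern2; field.
  have -> : (c + 2) / K%:R = c / K%:R + 2 * K%:R^-1 by ring.
  have -> : c / K.*2%:R = c / K%:R / 2 by rewrite -mul2n natrM; field; rewrite gt_eqF.
  have : 0 <= K.*2%:R^-1 :> R by rewrite invr_ge0.
  move: E; rewrite !ler_norml.
  have : 0 < K%:R^-1 :> R by rewrite invr_gt0.
  move: (c / K%:R) (K%:R^-1 : R) (K.*2%:R^-1 : R).
  move: (cos_sum K.*2 0) (cos_sum K 0) (cos_sum K.*2 pi) (pi ^+ 2 : R).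
  move=> y z w p u v v' v0 E v0'.
  move=> /andP[h1 h2] /andP[h3 h4]; apply/andP; split; lra.
have p0 := @pi_gt0 R.
have s0 : 0 < sin (x / 2) by apply: sin_gt0_pi; lra.
exists ((pi + 1) / (sin (x / 2) ^+ 2) * pi + c) => K K0.
have K0' : 0 < K%:R :> R by rewrite ltr0n.
rewrite -[a K x](subrK (a K pi)) mulrDl.
apply: (le_trans (ler_normD _ _)); rewrite lerD ?hc//.
have /cos_sum_err/le_trans : 0 < x <= pi by rewrite x0.
apply; rewrite invfM mulrA -mulrA [_^-1 * pi]mulrC mulrA.
apply: ler_wpM2l.
  by rewrite mulr_ge0 ?divr_ge0 ?exprn_ge0//; lra.
by rewrite lef_pV2 ?posrE// ler_nat.
Qed.

(** Once the error is known to tend to zero at each point, cos_sum_tail makes the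
rate uniform.  Points beyond 1 reduce to t <= 1 through t -> 2 - t. *)
Lemma cos_sum_bern2 K t : (0 < K)%N -> 0 <= t <= 2 ->
  `|cos_sum K (pi * t) - bern2 (pi * t)| <= K%:R^-1.
Proof.
move=> K0.
wlog t1 : t / t <= 1 => [H|] t02.
  have [t1|t1] := lerP t 1; first exact: H.
  have : `|cos_sum K (pi * (2 - t)) - bern2 (pi * (2 - t))| <= K%:R^-1.
    by apply: H; [lra|apply/andP; split; lra].
  have -> : bern2 (pi * (2 - t)) = bern2 (pi * t) by rewrite /bern2; field.
  suff -> : cos_sum K (pi * (2 - t)) = cos_sum K (pi * t) by [].
  apply: eq_bigr => n _; congr (_ / _).
  have -> : n.+1%:R * (pi * (2 - t)) = - (n.+1%:R * (pi * t)) + pi *+ 2 *+ n.+1 :> R.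
    by rewrite -(mulr_natl (pi *+ 2)) -(mulr_natl pi 2); ring.
  by rewrite (periodicn (@cosD2pi R)) cosN.
have p0 := @pi_gt0 R.
have [|c hc] := @cos_sum_bigO (pi * t).
  move: t02 => /andP[t0 _]; apply/andP; split; first by rewrite mulr_ge0 ?(ltW p0).
  by rewrite ger_pMr.
apply: (@ler_add_invn _ _ `|c|) => M M0.
have MK : (K <= M + K)%N by rewrite leq_addl.
have := cos_sum_tail (pi * t) K0 MK.
have MK0 : (0 < M + K)%N by rewrite addn_gt0 M0.
have := hc _ MK0; rewrite /a => h1 h2.
have h3 : c / (M + K)%:R <= `|c| / M%:R.
  have M0' : 0 < M%:R :> R by rewrite ltr0n.
  rewrite (le_trans (ler_norm _))// normrM ler_wpM2l//.
  by rewrite ger0_norm ?invr_ge0// lef_pV2 ?posrE ?ltr0n// ler_nat leq_addr.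
have h4 : 0 <= (M + K)%:R^-1 :> R by rewrite invr_ge0.
move: h1 h2; rewrite !ler_norml.
by move=> /andP[h1 h2] /andP[h5 h6]; apply/andP; split; lra.
Qed.

Definition triangle (d t : R) : R := Num.max (d - `|t|) 0.

(** The K-th partial sum of the Fourier series, on the period 2, of the triangle of
half-width d. *)
Definition triangle_series K (d t : R) : R := d ^+ 2 / 2 +
  \sum_(n < K) 2 / pi ^+ 2 * (1 - cos (n.+1%:R * (pi * d))) / n.+1%:R ^+ 2 *
     cos (n.+1%:R * (pi * t)).

Lemma triangle_seriesE K d t : triangle_series K d t =
  d ^+ 2 / 2 + 2 / pi ^+ 2 * (cos_sum K (pi * t) -
  (cos_sum K (pi * (t + d)) + cos_sum K (pi * (t - d))) / 2).
Proof.
rewrite /triangle_series /cos_sum; congr (_ + _).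
rewrite -big_split/= mulr_suml -sumrB mulr_sumr; apply: eq_bigr => n _.
have -> : n.+1%:R * (pi * (t + d)) = n.+1%:R * (pi * t) + n.+1%:R * (pi * d) by ring.
have -> : n.+1%:R * (pi * (t - d)) = n.+1%:R * (pi * t) - n.+1%:R * (pi * d) by ring.
have := natS_neq0 n; have := lt0r_neq0 (@pi_gt0 R).
rewrite cosD cosB; move: (pi : R) (n.+1%:R : R) => p m p0 m0.
by field; rewrite m0.
Qed.

(** In this form the triangle is a second difference of |t|, which is what the
second difference of the parabola in |t| produces. *)
Lemma triE d t : 0 <= d -> triangle d t = (`|t + d| + `|t - d|) / 2 - `|t|.
Proof.
by move=> d0; rewrite /triangle maxEge; case: ifP; case: (ger0P t);
  case: (ger0P (t + d)); case: (ger0P (t - d)); lra.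
Qed.

(** The condition on t keeps t - d, t and t + d in the interval where
cos_sum_bern2 applies. *)
Lemma triangle_series_err K d t : (0 < K)%N -> 0 <= d -> `|t| <= 2 - d ->
  `|triangle_series K d t - triangle d t| <= K%:R^-1.
Proof.
move=> K0 d0 td; have K0' : 0 < K%:R^-1 :> R by rewrite invr_gt0 ltr0n.
have cosabs s : cos_sum K (pi * s) = cos_sum K (pi * `|s|).
  apply: eq_bigr => n _; congr (_ / _); rewrite -cos_norm -[RHS]cos_norm.
  by rewrite !normrM normr_id.
have H s : `|s| <= 2 -> `|cos_sum K (pi * s) - bern2 (pi * `|s|)| <= K%:R^-1.
  by move=> s2; rewrite cosabs cos_sum_bern2// normr_ge0.
have h1 : `|t| <= 2 by lra.
have h2 : `|t + d| <= 2 by apply: (le_trans (ler_normD _ _)); rewrite (ger0_norm d0); lra.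
have h3 : `|t - d| <= 2 by apply: (le_trans (ler_normB _ _)); rewrite (ger0_norm d0); lra.
move: (H _ h1) (H _ h2) (H _ h3); rewrite triangle_seriesE triE//.
have sq : `|t + d| ^+ 2 + `|t - d| ^+ 2 = 2 * `|t| ^+ 2 + 2 * d ^+ 2.
  by rewrite !real_normK ?num_real//; ring.
move: sq; rewrite /bern2.
move: (cos_sum K (pi * t)) (cos_sum K (pi * (t + d))) (cos_sum K (pi * (t - d))).
move: `|t| `|t + d| `|t - d| => a0 a1 a2 c0 c1 c2 sq H0 H1 H2.
have p2 := @pi_ge2 R; have p0 := @pi_gt0 R.
move: (pi : R) p2 p0 H0 H1 H2 => p p2 p0 H0 H1 H2.
pose e0 := c0 - (p ^+ 2 / 6 - p * (p * a0) / 2 + (p * a0) ^+ 2 / 4).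
pose e1 := c1 - (p ^+ 2 / 6 - p * (p * a1) / 2 + (p * a1) ^+ 2 / 4).
pose e2 := c2 - (p ^+ 2 / 6 - p * (p * a2) / 2 + (p * a2) ^+ 2 / 4).
have -> : d ^+ 2 / 2 + 2 / p ^+ 2 * (c0 - (c1 + c2) / 2) - ((a1 + a2) / 2 - a0) =
  2 / p ^+ 2 * (e0 - (e1 + e2) / 2) +
  (2 * a0 ^+ 2 + 2 * d ^+ 2 - (a1 ^+ 2 + a2 ^+ 2)) / 4.
  by rewrite /e0 /e1 /e2; field; rewrite gt_eqF.
rewrite sq subrr mul0r addr0 normrM.
rewrite ger0_norm; last by rewrite divr_ge0 ?exprn_ge0// ltW.
have h : `|e0 - (e1 + e2) / 2| <= 2 * K%:R^-1.
  move: H0 H1 H2; rewrite -/e0 -/e1 -/e2 !ler_norml.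
  by move=> /andP[? ?] /andP[? ?] /andP[? ?]; apply/andP; split; lra.
have h' : 2 / p ^+ 2 <= 2^-1 :> R.
  have p4 : 2 * 2 <= p * p :> R by rewrite ler_pM.
  by rewrite ler_pdivrMr ?exprn_gt0// expr2; lra.
have -> : K%:R^-1 = 2^-1 * (2 * K%:R^-1) :> R by field; rewrite gt_eqF// ltr0n.
apply: ler_pM => //; rewrite ?divr_ge0 ?exprn_ge0//; exact: ltW.
Qed.

End Series.

(** * Integrable functions on the line and their cosine and sine transforms *)

Section RealIntegrals.
Variable R : realType.
Local Notation mu := (@lebesgue_measure R).
Implicit Types (f g h : R -> R) (a b x y : R).

Notation L1 g := (mu.-integrable setT (EFin \o g)).

Lemma integrable_measurable g : L1 g -> measurable_fun setT g.
Proof. by move=> /integrableP[mg _]; exact/measurable_EFinP. Qed.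

Lemma L1_eq f g : f =1 g -> L1 f -> L1 g.
Proof. by move=> /funext ->. Qed.

Lemma L1_le f g : measurable_fun setT f -> L1 g -> (forall x, `|f x| <= `|g x|) ->
  L1 f.
Proof.
move=> mf ig fg; apply: le_integrable ig => //; first exact/measurable_EFinP.
by move=> x _ /=; rewrite lee_fin.
Qed.

Lemma L1M_bounded g h C : L1 g -> measurable_fun setT h ->
  (forall x, `|h x| <= C) -> L1 (fun x => g x * h x).
Proof.
move=> ig mh hC; have mg := integrable_measurable ig.
have iCg : L1 (fun x => C * g x).
  by apply: eq_integrable (integrableZl _ C ig).
apply: (L1_le _ iCg); first exact: measurable_funM.
move=> x; rewrite !normrM mulrC ler_wpM2r//.
by rewrite (le_trans (hC x))// ler_norm.
Qed.

Lemma L1D f g : L1 f -> L1 g -> L1 (fun x => f x + g x).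
Proof. by move=> If Ig; apply: eq_integrable (integrableD _ If Ig). Qed.

Lemma L1B f g : L1 f -> L1 g -> L1 (fun x => f x - g x).
Proof. by move=> If Ig; apply: eq_integrable (integrableB _ If Ig). Qed.

Lemma L1Z c f : L1 f -> L1 (fun x => c * f x).
Proof. by move=> If; apply: eq_integrable (integrableZl _ c If). Qed.

Lemma L1_norm f : L1 f -> L1 (fun x => `|f x|).
Proof. exact: integrable_norm. Qed.

Lemma L1_sum K (F : nat -> R -> R) : (forall n, L1 (F n)) ->
  L1 (fun x => \sum_(n < K) F n x).
Proof.
move=> iF; elim: K => [|K IH].
  by apply: eq_integrable (integrable0 _ _) => // x _; rewrite /= big_ord0.
apply: eq_integrable (L1D IH (iF K)) => // x _.
by rewrite /= big_ord_recr.
Qed.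

Lemma Rintegral_sum K (F : nat -> R -> R) : (forall n, L1 (F n)) ->
  \int[mu]_x (\sum_(n < K) F n x) = \sum_(n < K) \int[mu]_x F n x.
Proof.
move=> iF; elim: K => [|K IH].
  rewrite big_ord0 -[RHS](@Rintegral_set0 _ _ _ mu (cst 0)) /Rintegral.
  rewrite integral_set0; congr fine; rewrite integral0_eq// => x _.
  by rewrite big_ord0.
rewrite big_ord_recr /= -IH -RintegralD//; last exact: L1_sum.
by apply: eq_Rintegral => x _; rewrite big_ord_recr.
Qed.

Lemma le_Rintegral_bounded g h C : L1 g -> measurable_fun setT h ->
  (forall x, `|h x| <= C) ->
  `|\int[mu]_x (g x * h x)| <= C * \int[mu]_x `|g x|.
Proof.
move=> ig mh hC; have igh := L1M_bounded ig mh hC.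
apply: (le_trans (le_normr_Rintegral _ _)) => //.
rewrite -RintegralZl//; last exact: L1_norm.
apply: le_Rintegral => //; [exact: L1_norm|exact/L1Z/L1_norm|].
by move=> x _; rewrite normrM mulrC ler_wpM2r.
Qed.

Lemma contD f g : continuous f -> continuous g -> continuous (fun x => f x + g x).
Proof. by move=> cf cg x; apply: (@continuousD _ _ _ f g); [exact: cf|exact: cg]. Qed.

Lemma contB f g : continuous f -> continuous g -> continuous (fun x => f x - g x).
Proof. by move=> cf cg x; apply: (@continuousB _ _ _ f g); [exact: cf|exact: cg]. Qed.

Lemma contM f g : continuous f -> continuous g -> continuous (fun x => f x * g x).
Proof. by move=> cf cg x; apply: (@continuousM _ _ f g); [exact: cf|exact: cg]. Qed.

Lemma cont_comp f g : continuous f -> continuous g -> continuous (fun x => f (g x)).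
Proof. by move=> cf cg x; apply: (@continuous_comp _ _ _ g f); [exact: cg|exact: cf]. Qed.

Lemma is_derive_continuous (f df : R -> R) :
  (forall x : R, is_derive x 1 f (df x)) -> continuous f.
Proof.
by move=> dfx x; have [/derivable1_diffP/differentiable_continuous] := dfx x.
Qed.

Lemma continuous_cosMr y : continuous (fun w : R => cos (w * y)).
Proof.
by apply: (@is_derive_continuous _ (fun w => - sin (w * y) * y)) => x;
  apply: is_derive_eq; rewrite /GRing.scale/=; ring.
Qed.

Lemma continuous_sinMr y : continuous (fun w : R => sin (w * y)).
Proof.
by apply: (@is_derive_continuous _ (fun w => cos (w * y) * y)) => x;
  apply: is_derive_eq; rewrite /GRing.scale/=; ring.
Qed.

Lemma measurable_cosM w : measurable_fun setT (fun x : R => cos (w * x)).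
Proof.
apply: continuous_measurable_fun; have := @continuous_cosMr w.
by under eq_fun do rewrite mulrC.
Qed.

Lemma measurable_sinM w : measurable_fun setT (fun x : R => sin (w * x)).
Proof.
apply: continuous_measurable_fun; have := @continuous_sinMr w.
by under eq_fun do rewrite mulrC.
Qed.

Definition cosT g w : R := \int[mu]_x (g x * cos (w * x)).
Definition sinT g w : R := \int[mu]_x (g x * sin (w * x)).

Lemma L1_cos g w : L1 g -> L1 (fun x => g x * cos (w * x)).
Proof.
by move=> ig; apply: (L1M_bounded ig (measurable_cosM w)) => x; exact: cos_max.
Qed.

Lemma L1_sin g w : L1 g -> L1 (fun x => g x * sin (w * x)).
Proof.
by move=> ig; apply: (L1M_bounded ig (measurable_sinM w)) => x; exact: sin_max.
Qed.

Lemma continuous_cosT g : L1 g -> continuous (cosT g).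
Proof.
move=> ig w.
have ag : L1 (fun x => `|g x|) := L1_norm ig.
apply: (@continuity_under_integral _ _ _ mu (fun w x => g x * cos (w * x)) setT
  measurableT (w - 1) (w + 1) _ _ _ ag).
- by move=> t _; exact: L1_cos.
- apply/nearW => y _ t _ /=; apply: continuousM; first exact: cvg_cst.
  exact: continuous_cosMr.
- move=> t _; apply/nearW => y _; rewrite normrM -[leRHS]mulr1 ler_wpM2l//.
  exact: cos_max.
- by rewrite inE/= in_itv/=; apply/andP; split; lra.
Qed.

Lemma continuous_sinT g : L1 g -> continuous (sinT g).
Proof.
move=> ig w.
have ag : L1 (fun x => `|g x|) := L1_norm ig.
apply: (@continuity_under_integral _ _ _ mu (fun w x => g x * sin (w * x)) setT
  measurableT (w - 1) (w + 1) _ _ _ ag).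
- by move=> t _; exact: L1_sin.
- apply/nearW => y _ t _ /=; apply: continuousM; first exact: cvg_cst.
  exact: continuous_sinMr.
- move=> t _; apply/nearW => y _; rewrite normrM -[leRHS]mulr1 ler_wpM2l//.
  exact: sin_max.
- by rewrite inE/= in_itv/=; apply/andP; split; lra.
Qed.

(** The Riemann sum behind the integral of min(N, M / xi^2): use N for the first m
terms and a telescoping bound for the others. *)
Lemma sum_min_le K m (N D : R) : (0 < m)%N -> 0 <= N -> 0 <= D ->
  \sum_(n < K) Num.min N (D / n.+1%:R ^+ 2) <= m%:R * N + D / m%:R.
Proof.
move=> m0 N0 D0.
have H1 k : \sum_(n < k) Num.min N (D / n.+1%:R ^+ 2) <= k%:R * N.
  elim: k => [|k IH]; first by rewrite big_ord0 mul0r.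
  by rewrite big_ord_recr/= -natr1 mulrDl mul1r lerD// ge_min lexx.
have H2 k : \sum_(n < k + m) Num.min N (D / n.+1%:R ^+ 2) <=
    m%:R * N + D * (m%:R^-1 - (k + m)%:R^-1).
  elim: k => [|k IH]; first by rewrite add0n subrr mulr0 addr0 H1.
  rewrite addSn big_ord_recr/=; apply: (le_trans (lerD IH (_ : _ <= _))).
    by rewrite ge_min; apply/orP; right; exact: lexx.
  have p0 : 0 < (k + m)%:R :> R by rewrite ltr0n addn_gt0 m0 orbT.
  rewrite -[(k + m).+1%:R]natr1; move: ((k + m)%:R : R) p0 => p p0.
  rewrite -addrA lerD2l -mulrDr ler_wpM2l//.
  have p1 : 0 < p + 1 by rewrite addr_gt0.
  move: (m%:R^-1 : R) => u.
  rewrite -subr_ge0 (_ : _ - _ = (p * (p + 1) ^+ 2)^-1); last first.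
    by field; rewrite (lt0r_neq0 p0) (lt0r_neq0 p1).
  by rewrite invr_ge0 mulr_ge0 ?exprn_ge0 ?ltW.
have [Km|mK] := leqP K m.
  apply: (le_trans (H1 K)); rewrite -[leLHS]addr0 lerD ?divr_ge0//.
  by rewrite ler_wpM2r// ler_nat.
rewrite -(subnK (ltnW mK)); apply: (le_trans (H2 _)).
by rewrite lerD2l mulrBr gerBl divr_ge0.
Qed.

Lemma abs_sin_le x : `|sin x| <= `|x|.
Proof.
wlog x0 : x / 0 <= x => [H|].
  have [|x0] := lerP 0 x; first exact: H.
  by rewrite -normrN -sinN -[leRHS]normrN; apply: H; lra.
have := @mean_value_le _ (@sin R) (@cos R) 0 x 1 x0.
rewrite sin0 !subr0 mul1r (ger0_norm x0); by apply => y _; exact: cos_max.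
Qed.

Lemma one_sub_cos_le x : 0 <= 1 - cos x <= x ^+ 2 / 2.
Proof.
have -> : cos x = 1 - 2 * sin (x / 2) ^+ 2.
  have {1}-> : x = (x / 2) *+ 2 by rewrite -mulr_natr; field.
  by rewrite cos_mulr2n cos2sin2; ring.
have : `|sin (x / 2)| ^+ 2 <= `|x / 2| ^+ 2.
  by rewrite ler_sqr ?nnegrE//; exact: abs_sin_le.
rewrite !real_normK ?num_real// => h.
have := sqr_ge0 (sin (x / 2)).
have : (x / 2) ^+ 2 = x ^+ 2 / 4 by field.
by move=> E h0; apply/andP; split; lra.
Qed.

End RealIntegrals.

(** * Integrals against triangles, and a periodic kernel that imitates a triangle *)

Section Triangle.
Variable R : realType.
Local Notation mu := (@lebesgue_measure R).
Notation L1 g := (mu.-integrable setT (EFin \o g)).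
Implicit Types (f g h : R -> R) (a b x y d : R).

Lemma Rintegral_FTC2 (f F : R -> R) a b : a <= b ->
  (forall x : R, is_derive x 1 F (f x)) -> continuous f ->
  \int[mu]_(x in `[a, b]) f x = F b - F a.
Proof.
move=> ab dF cf; move: ab; rewrite le_eqVlt => /predU1P[<-|ab].
  by rewrite set_itv1 Rintegral_set1 subrr.
have cF := is_derive_continuous dF.
rewrite /Rintegral (@continuous_FTC2 _ f F a b ab)//.
- exact: continuous_subspaceT.
- split.
  + by move=> x _; have [] := dF x.
  + by apply: cvg_at_right_filter; exact: cF.
  + by apply: cvg_at_left_filter; exact: cF.
- by move=> x _; rewrite derive1E; have [_ ->] := dF x.
Qed.

Lemma continuous_tri d : continuous (triangle d).
Proof.
move=> t; rewrite /triangle; apply: (@continuous_max _ _ (fun t : R => d - `|t|) (cst 0)).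
  apply: (@continuousB _ _ _ (cst d) (fun t : R => `|t|)); first exact: cvg_cst.
  exact: norm_continuous.
exact: cvg_cst.
Qed.

Lemma patch_supp (h : R -> R) a b : (forall x, ~~ (a <= x <= b) -> h x = 0) ->
  h \_ `[a, b] = h.
Proof.
move=> h0; apply: funext => x; rewrite patchE; case: ifPn => // /negP xab.
by rewrite h0//; apply/negP => ?; apply: xab; rewrite inE/= in_itv.
Qed.

Lemma Rintegral_supp (h : R -> R) a b : (forall x, ~~ (a <= x <= b) -> h x = 0) ->
  \int[mu]_x h x = \int[mu]_(x in `[a, b]) h x.
Proof. by move=> h0; rewrite [RHS]Rintegral_mkcond patch_supp. Qed.

Lemma integrable_continuous_itv (h : R -> R) a b : continuous h ->
  mu.-integrable `[a, b] (EFin \o h).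
Proof.
move=> ch; apply: continuous_compact_integrable; first exact: segment_compact.
exact: continuous_subspaceT.
Qed.

Lemma L1_supp (h : R -> R) a b : continuous h ->
  (forall x, ~~ (a <= x <= b) -> h x = 0) -> L1 h.
Proof.
move=> ch h0; have /integrable_mkcond := integrable_continuous_itv a b ch.
move=> /(_ (measurable_itv _)); apply: eq_integrable => // x _.
rewrite patchE; case: ifPn => //= /negP xab.
by rewrite h0//; apply/negP => ?; apply: xab; rewrite inE/= in_itv.
Qed.

Lemma Rintegral_split (h : R -> R) a x b : continuous h -> a <= x <= b ->
  \int[mu]_(y in `[a, b]) h y =
  \int[mu]_(y in `[a, x]) h y + \int[mu]_(y in `[x, b]) h y.
Proof.
move=> ch /andP[ax xb]; apply/eqP; rewrite addrC -subr_eq; apply/eqP.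
rewrite Rintegral_itvB ?bnd_simp//; last exact: integrable_continuous_itv.
rewrite Rintegral_itv_obnd_cbnd//; apply: integrableS (integrable_continuous_itv x b ch) => //.
exact: subset_itv_oc_cc.
Qed.

Lemma tri_ge0 d t : 0 <= triangle d t.
Proof. by rewrite /triangle le_max lexx orbT. Qed.

Lemma tri_le d t : 0 <= d -> triangle d t <= d.
Proof. by move=> d0; rewrite /triangle ge_max d0 gerBl normr_ge0. Qed.

Lemma tri_out d t : d <= `|t| -> triangle d t = 0.
Proof. by move=> dt; rewrite /triangle max_r// subr_le0. Qed.

Lemma tri_in d t : `|t| <= d -> triangle d t = d - `|t|.
Proof. by move=> dt; rewrite /triangle max_l// subr_ge0. Qed.

Lemma tri_supp d x y : ~~ (x - d <= y <= x + d) -> triangle d (x - y) = 0.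
Proof.
move=> h; apply: tri_out; rewrite leNgt; apply/negP; rewrite ltr_norml => /andP[h1 h2].
by move/negP: h; apply; apply/andP; split; lra.
Qed.

Lemma continuous_tri_sub d x : continuous (fun y => triangle d (x - y)).
Proof.
move=> y; apply: (@continuous_comp _ _ _ (fun y => x - y) (triangle d)).
  by apply: (@continuousB _ _ _ (cst x) id); [exact: cvg_cst|exact: cvg_id].
exact: continuous_tri.
Qed.

(** Integrating against a triangle takes a second difference of a second primitive;
this gives every explicit integral of u0 at once. *)
Lemma Rintegral_tri (P P' p : R -> R) x d : 0 <= d ->
  (forall y : R, is_derive y 1 P (P' y)) ->
  (forall y : R, is_derive y 1 P' (p y)) -> continuous p ->
  \int[mu]_y (triangle d (x - y) * p y) = P (x + d) + P (x - d) - 2 * P x.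
Proof.
move=> d0 dP dP' cp.
have ch : continuous (fun y => triangle d (x - y) * p y).
  by move=> y; apply: (@continuousM _ _ (fun y => triangle d (x - y)) p);
    [exact: continuous_tri_sub|exact: cp].
rewrite (@Rintegral_supp _ (x - d) (x + d)); last first.
  by move=> y /tri_supp ->; rewrite mul0r.
rewrite (@Rintegral_split _ _ x)//; last by apply/andP; split; lra.
pose G y := (d - x + y) * P' y - P y.
pose H y := (d + x - y) * P' y + P y.
have -> : \int[mu]_(y in `[x - d, x]) (triangle d (x - y) * p y) = G x - G (x - d).
  have dG (y : R) : is_derive y 1 G ((d - x + y) * p y).
    have := dP y; have := dP' y => ? ?.
    by rewrite /G; apply: is_derive_eq; rewrite /GRing.scale/=; ring.
  have cG : continuous (fun y => (d - x + y) * p y).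
    move=> y; apply: (@continuousM _ _ (fun y => d - x + y) p); last exact: cp.
    by apply: (@continuousD _ _ _ (cst (d - x)) id); [exact: cvg_cst|exact: cvg_id].
  rewrite -(Rintegral_FTC2 _ dG cG); last by lra.
  apply: eq_Rintegral => y; rewrite inE/= in_itv/= => /andP[h1 h2].
  by rewrite tri_in ?ger0_norm; [congr (_ * _); ring|lra|lra|lra].
have -> : \int[mu]_(y in `[x, x + d]) (triangle d (x - y) * p y) = H (x + d) - H x.
  have dH (y : R) : is_derive y 1 H ((d + x - y) * p y).
    have := dP y; have := dP' y => ? ?.
    by rewrite /H; apply: is_derive_eq; rewrite /GRing.scale/=; ring.
  have cH : continuous (fun y => (d + x - y) * p y).
    move=> y; apply: (@continuousM _ _ (fun y => d + x - y) p); last exact: cp.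
    by apply: (@continuousB _ _ _ (cst (d + x)) id); [exact: cvg_cst|exact: cvg_id].
  rewrite -(Rintegral_FTC2 _ dH cH); last by lra.
  apply: eq_Rintegral => y; rewrite inE/= in_itv/= => /andP[h1 h2].
  by rewrite tri_in ?ler0_norm; [congr (_ * _); ring|lra|lra|lra].
by rewrite /G /H; ring.
Qed.

Lemma L1_tri d x : L1 (fun y => triangle d (x - y)).
Proof.
by apply: (@L1_supp _ (x - d) (x + d)); [exact: continuous_tri_sub|exact: tri_supp].
Qed.

Lemma Rintegral_tri1 x d : 0 <= d -> \int[mu]_y triangle d (x - y) = d ^+ 2.
Proof.
move=> d0.
have dP (y : R) : is_derive y 1 (fun y : R => y ^+ 2 / 2) y.
  by apply: is_derive_eq; rewrite /GRing.scale/=; field.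
have dI (y : R) : is_derive y 1 (fun y : R => y) 1.
  by apply: is_derive_eq.
have c1 : continuous (cst (1 : R) : R -> R) by exact: cst_continuous.
have := @Rintegral_tri _ id (cst 1) x d d0 dP dI c1.
have -> : \int[mu]_y (triangle d (x - y) * cst 1 y) = \int[mu]_y triangle d (x - y).
  by apply: eq_Rintegral => y _; rewrite mulr1.
by move=> ->; field.
Qed.

(** The triangle series rescaled to the period 2L; for large L it imitates a single
triangle on the whole line while involving only the frequencies n / (2L). *)
Definition cos_kernel (L d : R) K (t : R) : R := L * triangle_series K (d / L) (t / L).

Lemma cos_kernelE L d K t : 0 < L -> cos_kernel L d K t = d ^+ 2 / (2 * L) +
  \sum_(n < K) 2 * L / (pi * n.+1%:R) ^+ 2 * (1 - cos (pi * n.+1%:R / L * d)) *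
     cos (pi * n.+1%:R / L * t).
Proof.
move=> L0; rewrite /cos_kernel /triangle_series mulrDr; congr (_ + _).
  by field; rewrite gt_eqF.
rewrite mulr_sumr; apply: eq_bigr => n _.
have -> : pi * n.+1%:R / L * d = n.+1%:R * (pi * (d / L)) by ring.
have -> : pi * n.+1%:R / L * t = n.+1%:R * (pi * (t / L)) by ring.
have := natS_neq0 R n; have := lt0r_neq0 (@pi_gt0 R).
move: (pi : R) (n.+1%:R : R) => p m p0 m0.
by field; rewrite m0.
Qed.

(** From 1 - cos z <= z^2 / 2.  As the bound does not depend on n, the kernel turns
an integral into a plain Riemann sum of the transform. *)
Lemma cos_kernel_coef L d n : 0 < L ->
  0 <= 2 * L / (pi * n.+1%:R) ^+ 2 * (1 - cos (pi * n.+1%:R / L * d)) <= d ^+ 2 / L.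
Proof.
move=> L0; have /andP[h1 h2] := one_sub_cos_le (pi * n.+1%:R / L * d).
have c0 : 0 <= 2 * L / (pi * n.+1%:R) ^+ 2.
  by rewrite divr_ge0 ?exprn_ge0 ?mulr_ge0 ?(ltW (pi_gt0 R))// ltW.
rewrite mulr_ge0//=; apply: (le_trans (ler_wpM2l c0 h2)).
rewrite le_eqVlt; apply/orP; left; apply/eqP.
have := natS_neq0 R n; have := lt0r_neq0 (@pi_gt0 R).
move: (pi : R) (n.+1%:R : R) => p m p0 m0.
by field; rewrite m0 p0 gt_eqF.
Qed.

Lemma cos_kernel_err L d K t : 0 < L -> (0 < K)%N -> 0 <= d -> `|t| <= 2 * L - d ->
  `|cos_kernel L d K t - triangle d t| <= L / K%:R.
Proof.
move=> L0 K0 d0 td.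
have -> : triangle d t = L * triangle (d / L) (t / L).
  rewrite /triangle maxr_pMr ?(ltW L0)// mulr0 mulrBr normrM.
  rewrite (@ger0_norm _ L^-1) ?invr_ge0 ?(ltW L0)//.
  by rewrite mulrCA divff ?mulr1 1?mulrCA ?divff ?mulr1// gt_eqF.
rewrite -mulrBr normrM (ger0_norm (ltW L0)); apply: ler_wpM2l; first exact: (ltW L0).
apply: triangle_series_err => //; first by rewrite divr_ge0 ?(ltW L0).
rewrite normrM (@ger0_norm _ L^-1) ?invr_ge0 ?(ltW L0)//.
by rewrite ler_pdivrMr// mulrBl divfK// gt_eqF.
Qed.

(** The coefficients are nonnegative, so the kernel is largest at 0, where it is
close to the height d of the triangle. *)
Lemma cos_kernel_bound L d K t : 0 < L -> (0 < K)%N -> 0 <= d -> d <= 2 * L ->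
  `|cos_kernel L d K t| <= d + L / K%:R.
Proof.
move=> L0 K0 d0 dL; apply: (@le_trans _ _ (cos_kernel L d K 0)).
  rewrite !cos_kernelE//; apply: (le_trans (ler_normD _ _)).
  rewrite ger0_norm ?divr_ge0 ?sqr_ge0 ?mulr_ge0 ?(ltW L0)// lerD2l.
  apply: (le_trans (ler_norm_sum _ _ _)); apply: ler_sum => n _.
  have /andP[h1 _] := cos_kernel_coef d n L0.
  by rewrite mulr0 cos0 normrM (ger0_norm h1) ler_wpM2l// cos_max.
have := @cos_kernel_err L d K 0 L0 K0 d0; rewrite normr0 subr_ge0 => /(_ dL).
rewrite (@tri_in d 0) ?normr0// subr0 ler_norml => /andP[_ h].
by rewrite -lerBlDl.
Qed.

End Triangle.

(** * A quantitative substitute for Fourier inversion *)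

Section Inversion.
Variable R : realType.
Local Notation mu := (@lebesgue_measure R).
Notation L1 g := (mu.-integrable setT (EFin \o g)).
Implicit Types (g : R -> R) (x y d w : R).

Lemma cosM_sub w x y :
  cos (w * (x - y)) = cos (w * x) * cos (w * y) + sin (w * x) * sin (w * y) :> R.
Proof. by rewrite mulrBr cosB. Qed.

Lemma L1_cos_sub g w x : L1 g -> L1 (fun y => g y * cos (w * (x - y))).
Proof.
move=> ig; apply: (@L1_eq _ (fun y => cos (w * x) * (g y * cos (w * y)) +
                             sin (w * x) * (g y * sin (w * y)))).
  by move=> y; rewrite cosM_sub; ring.
by apply: L1D; apply: L1Z; [exact: L1_cos|exact: L1_sin].
Qed.

Lemma Rintegral_cos_sub g w x : L1 g ->
  \int[mu]_y (g y * cos (w * (x - y))) = cos (w * x) * cosT g w + sin (w * x) * sinT g w.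
Proof.
move=> ig; rewrite /cosT /sinT -RintegralZl//; last exact: L1_cos.
rewrite -(RintegralZl _ _ (L1_sin w ig))// -RintegralD//; last 2 first.
- by apply/L1Z/L1_cos.
- by apply/L1Z/L1_sin.
by apply: eq_Rintegral => y _; rewrite cosM_sub; ring.
Qed.

Lemma Rintegral_cos_sub_le g w x (M : R) : L1 g -> `|cosT g w| <= M -> `|sinT g w| <= M ->
  `|\int[mu]_y (g y * cos (w * (x - y)))| <= 2 * M.
Proof.
move=> ig cM sM; rewrite Rintegral_cos_sub//; apply: (le_trans (ler_normD _ _)).
rewrite !normrM mulr2n mulrDl mul1r; apply: lerD.
  by rewrite -[M]mul1r ler_pM// cos_max.
by rewrite -[M]mul1r ler_pM// sin_max.
Qed.

Lemma cosT_le g w : L1 g -> `|cosT g w| <= \int[mu]_x `|g x|.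
Proof.
move=> ig; rewrite -[leRHS]mul1r; apply: le_Rintegral_bounded => //.
  exact: measurable_cosM.
by move=> x; exact: cos_max.
Qed.

Lemma sinT_le g w : L1 g -> `|sinT g w| <= \int[mu]_x `|g x|.
Proof.
move=> ig; rewrite -[leRHS]mul1r; apply: le_Rintegral_bounded => //.
  exact: measurable_sinM.
by move=> x; exact: sin_max.
Qed.

Lemma Rintegral_dominated_cvg (F : nat -> R -> R) f G : (forall n, L1 (F n)) -> L1 f ->
  L1 G -> (forall x, F ^~ x @ \oo --> f x) -> (forall n x, `|F n x| <= G x) ->
  \int[mu]_x F n x @[n --> \oo] --> \int[mu]_x f x.
Proof.
move=> iF If iG Ff FG; apply: fine_cvg.
rewrite fineK; last exact: integrable_fin_num.
apply: (@dominated_cvg _ _ _ mu _ _ (fun n x => (F n x)%:E) _ (EFin \o G)) => //=.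
- by move=> n; have /integrableP[] := iF n.
- by move=> x _; apply: cvg_EFin; [exact: nearW|exact: Ff].
- by move=> n x _; rewrite lee_fin.
Qed.

Let coef (L d : R) n := 2 * L / (pi * n.+1%:R) ^+ 2 * (1 - cos (pi * n.+1%:R / L * d)).

Lemma mul_cos_kernelE g L d K x y : 0 < L -> g y * cos_kernel L d K (x - y) =
  d ^+ 2 / (2 * L) * g y +
  \sum_(n < K) coef L d n * (g y * cos (pi * n.+1%:R / L * (x - y))).
Proof.
move=> L0; rewrite cos_kernelE// mulrDr mulr_sumr mulrC; congr (_ + _).
by apply: eq_bigr => n _; rewrite /coef; ring.
Qed.

Lemma L1_cos_kernel g L d K x : 0 < L -> L1 g -> L1 (fun y => g y * cos_kernel L d K (x - y)).
Proof.
move=> L0 ig.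
apply: (@L1_eq _ (fun y => d ^+ 2 / (2 * L) * g y +
  \sum_(n < K) coef L d n * (g y * cos (pi * n.+1%:R / L * (x - y))))).
  by move=> y; rewrite mul_cos_kernelE.
apply: L1D; first exact: L1Z.
apply: (@L1_sum _ K (fun n y => coef L d n * (g y * cos (pi * n.+1%:R / L * (x - y))))) => n.
exact/L1Z/L1_cos_sub.
Qed.

Lemma Rintegral_cos_kernel g L d K x : 0 < L -> L1 g ->
  \int[mu]_y (g y * cos_kernel L d K (x - y)) = d ^+ 2 / (2 * L) * \int[mu]_y g y +
  \sum_(n < K) coef L d n * \int[mu]_y (g y * cos (pi * n.+1%:R / L * (x - y))).
Proof.
move=> L0 ig.
have iF n : L1 (fun y => coef L d n * (g y * cos (pi * n.+1%:R / L * (x - y)))).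
  by apply/L1Z/L1_cos_sub.
under eq_Rintegral do rewrite mul_cos_kernelE//.
rewrite RintegralD//; [|exact: L1Z|exact: (@L1_sum _ K _ iF)].
rewrite RintegralZl// (Rintegral_sum _ iF); congr (_ + _).
by apply: eq_bigr => n _; rewrite RintegralZl//; exact: L1_cos_sub.
Qed.

Section Bound.
Variables (g : R -> R) (N M S : R).
Hypotheses (ig : L1 g) (gN : \int[mu]_x `|g x| <= N) (M0 : 0 <= M) (S0 : 0 < S).
Hypothesis cosTM : forall xi, `|cosT g (2 * pi * xi)| * xi ^+ 2 <= M.
Hypothesis sinTM : forall xi, `|sinT g (2 * pi * xi)| * xi ^+ 2 <= M.

Lemma bound_ge0 : 0 <= N.
Proof. by apply: le_trans gN; apply: Rintegral_ge0. Qed.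

(** With L = m / (2S) the frequencies n / (2L) = n S / m number m below S, and
sum_min_le applies with the cut at n = m. *)
Lemma Rintegral_cos_kernel_le d K m x : (0 < m)%N -> 0 <= d ->
  `|\int[mu]_y (g y * cos_kernel (m%:R / (2 * S)) d K (x - y))| <=
  d ^+ 2 * (5 * S * N + 4 * M / S).
Proof.
move=> m0 d0; have N0 := bound_ge0.
have m0' : 0 < m%:R :> R by rewrite ltr0n.
set L := m%:R / (2 * S); have L0 : 0 < L by rewrite divr_gt0 ?mulr_gt0.
rewrite Rintegral_cos_kernel//; apply: (le_trans (ler_normD _ _)).
set D := M * (m%:R / S) ^+ 2.
have D0 : 0 <= D by rewrite mulr_ge0// sqr_ge0.
have h1 : `|d ^+ 2 / (2 * L) * \int[mu]_y g y| <= d ^+ 2 / L * (N / 2).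
  have c0 : 0 <= d ^+ 2 / (2 * L).
    by apply: divr_ge0; [exact: sqr_ge0|apply: mulr_ge0 => //; exact: (ltW L0)].
  rewrite normrM (ger0_norm c0).
  have -> : d ^+ 2 / L * (N / 2) = d ^+ 2 / (2 * L) * N by field; rewrite gt_eqF.
  apply: ler_wpM2l => //.
  by apply: (le_trans (le_normr_Rintegral _ _)).
have h2 : `|\sum_(n < K) coef L d n * \int[mu]_y (g y * cos (pi * n.+1%:R / L * (x - y)))|
   <= d ^+ 2 / L * (2 * (m%:R * N + D / m%:R)).
  apply: (le_trans (ler_norm_sum _ _ _)).
  apply: (@le_trans _ _ (d ^+ 2 / L * (2 * \sum_(n < K) Num.min N (D / n.+1%:R ^+ 2)))); last first.
    apply: ler_wpM2l; first by apply: divr_ge0; [exact: sqr_ge0|exact: (ltW L0)].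
    by rewrite ler_wpM2l// sum_min_le.
  rewrite [leRHS]mulrA mulr_sumr; apply: ler_sum => n _; rewrite normrM -[leRHS]mulrA.
  have /andP[c0 cd] := cos_kernel_coef d n L0.
  rewrite (ger0_norm c0); apply: ler_pM => //.
  have n0 : 0 < n.+1%:R :> R by [].
  have -> : pi * n.+1%:R / L = 2 * pi * (n.+1%:R * S / m%:R).
    by rewrite /L; move: (pi : R) => p; field; rewrite !gt_eqF.
  have H (q : R) : `|q| * (n.+1%:R * S / m%:R) ^+ 2 <= M -> `|q| <= D / n.+1%:R ^+ 2.
    move=> h; rewrite /D; move: h.
    rewrite -ler_pdivlMr ?exprn_gt0 ?divr_gt0 ?mulr_gt0// => /le_trans; apply.
    by rewrite le_eqVlt; apply/orP; left; apply/eqP; field; rewrite !gt_eqF.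
  by apply: Rintegral_cos_sub_le => //; rewrite le_min (le_trans _ gN) ?cosT_le ?sinT_le ?H.
apply: (le_trans (lerD h1 h2)); rewrite -mulrDr /D /L.
have -> : d ^+ 2 / (m%:R / (2 * S)) *
   (N / 2 + 2 * (m%:R * N + M * (m%:R / S) ^+ 2 / m%:R)) =
  d ^+ 2 * (S * N / m%:R + 4 * S * N + 4 * M / S) by field; rewrite !gt_eqF.
apply: ler_wpM2l; first exact: sqr_ge0.
have : S * N / m%:R <= S * N.
  rewrite ler_pdivrMr//; apply: ler_peMr; last by rewrite ler1n.
  by rewrite mulr_ge0// (ltW S0).
by lra.
Qed.

(** Dominated convergence along L = m / (2S) and K = m^2: the error L / K of the
kernel tends to zero on intervals that exhaust the line, and the kernels are
uniformly bounded. *)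
Lemma Rintegral_tri_le d x : 0 <= d ->
  `|\int[mu]_y (g y * triangle d (x - y))| <= d ^+ 2 * (5 * S * N + 4 * M / S).
Proof.
move=> d0.
(* starting at m0 guarantees d <= 2L for every term of the sequence *)
pose m0 := (Num.bound (S * d)).+1.
pose m n := (n + m0)%N.
pose L n : R := (m n)%:R / (2 * S).
pose F n y := g y * cos_kernel (L n) d ((m n) ^ 2) (x - y).
have mp n : (0 < m n)%N by rewrite /m /m0 addnS.
have L0 n : 0 < L n by rewrite divr_gt0 ?mulr_gt0// ltr0n.
have Lm n : L n / ((m n) ^ 2)%:R = (2 * S)^-1 / (m n)%:R.
  have := mp n; rewrite -(ltr0n R) => ?.
  by rewrite /L natrX; field; rewrite !gt_eqF.
have Ld n : d <= 2 * L n.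
  rewrite /L (_ : 2 * _ = (m n)%:R / S); last by field; rewrite gt_eqF.
  rewrite ler_pdivlMr// mulrC; apply: ltW.
  have /archi_boundP/lt_le_trans : 0 <= S * d by rewrite mulr_ge0// ltW.
  by apply; rewrite ler_nat /m /m0 addnS -addSn leq_addl.
have cvgF y : F ^~ y @ \oo --> g y * triangle d (x - y).
  apply: cvgM; first exact: cvg_cst.
  apply/cvgrPdist_le => e e0.
  (* the first term places x - y inside the period, the second makes L / K small *)
  exists (Num.bound (S * (`|x - y| + d))%R + Num.bound ((2 * S)^-1 / e)%R)%N => // n /= Nn.
  have nm : (n%:R <= (m n)%:R :> R) by rewrite ler_nat /m leq_addr.
  rewrite distrC; apply: (le_trans (cos_kernel_err (L0 n) _ d0 _)).
  - by rewrite expn_gt0 mp.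
  - rewrite lerBrDr /L (_ : 2 * _ = (m n)%:R / S); last by field; rewrite gt_eqF.
    rewrite ler_pdivlMr// mulrC; apply: ltW.
    have /archi_boundP/lt_le_trans : 0 <= S * (`|x - y| + d).
      by rewrite mulr_ge0 ?addr_ge0// (ltW S0).
    by apply; apply: (le_trans _ nm); rewrite ler_nat (leq_trans _ Nn)// leq_addr.
  - rewrite Lm ler_pdivrMr ?ltr0n// [leRHS]mulrC -ler_pdivrMr//; apply: ltW.
    have /archi_boundP/lt_le_trans : 0 <= (2 * S)^-1 / e.
      by rewrite divr_ge0 ?(ltW e0)// invr_ge0 mulr_ge0// (ltW S0).
    by apply; apply: (le_trans _ nm); rewrite ler_nat (leq_trans _ Nn)// leq_addl.
have bF n y : `|F n y| <= (d + (2 * S)^-1) * `|g y|.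
  rewrite /F normrM mulrC; apply: ler_wpM2r => //.
  apply: (le_trans (@cos_kernel_bound _ _ _ _ _ (L0 n) _ d0 (Ld n))); first by rewrite expn_gt0 mp.
  rewrite Lm lerD2l ler_pdivrMr ?ltr0n//; apply: ler_peMr; last by rewrite ler1n.
  by rewrite invr_ge0 mulr_ge0// (ltW S0).
have cvgI : \int[mu]_y F n y @[n --> \oo] --> \int[mu]_y (g y * triangle d (x - y)).
  apply: (@Rintegral_dominated_cvg F _ (fun y => (d + (2 * S)^-1) * `|g y|)) => //.
  - by move=> n; exact: L1_cos_kernel.
  - apply: (@L1M_bounded _ _ _ d) => //.
      by apply: continuous_measurable_fun; exact: continuous_tri_sub.
    by move=> y; rewrite ger0_norm ?tri_ge0// tri_le.
  - exact/L1Z/L1_norm.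
apply: (cvgr_to_le (cvg_norm cvgI)); apply: nearW => n.
exact: Rintegral_cos_kernel_le.
Qed.

End Bound.
End Inversion.

(** * From triangle averages to almost everywhere bounds *)

Section LebesguePoints.
Variable R : realType.
Local Notation mu := (@lebesgue_measure R).
Notation L1 g := (mu.-integrable setT (EFin \o g)).
Implicit Types (g : R -> R) (x y d w : R).

Lemma L1_lebesgue_pt g : L1 g -> {ae mu, forall x, lebesgue_pt g x}.
Proof.
move=> ig; apply: lebesgue_differentiation.
by have := integrable_locally measurableT ig; rewrite patch_setT.
Qed.

(** A triangle is at most d times the indicator of its support, and has integral
d^2; so the deviation of a triangle average from the value at x is controlled
by the mean deviation over a ball. *)
Lemma tri_davg g x d : L1 g -> 0 < d ->
  (`|\int[mu]_y (g y * triangle d (x - y)) - d ^+ 2 * g x|%:E <=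
   (2 * d ^+ 2)%:E * davg g x d)%E.
Proof.
move=> ig d0; have d0' := ltW d0.
have mg := integrable_measurable ig.
have itri : L1 (fun y => g y * triangle d (x - y)).
  apply: (@L1M_bounded _ _ _ d) => //.
    by apply: continuous_measurable_fun; exact: continuous_tri_sub.
  by move=> y; rewrite ger0_norm ?tri_ge0// tri_le.
have icst : L1 (fun y => g x * triangle d (x - y)) by apply/L1Z/L1_tri.
have -> : \int[mu]_y (g y * triangle d (x - y)) - d ^+ 2 * g x =
    \int[mu]_y (g y * triangle d (x - y) - g x * triangle d (x - y)).
  by rewrite RintegralB// RintegralZl ?Rintegral_tri1 1?mulrC//; exact: L1_tri.
pose h y := g y * triangle d (x - y) - g x * triangle d (x - y).
have ih : L1 h by exact: L1B.
have mh := integrable_measurable ih.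
rewrite EFin_normr_Rintegral//.
apply: (le_trans (le_abse_integral _ _ _)) => //; first exact/measurable_EFinP.
have mb : measurable (ball x d) by exact: measurable_ball.
have -> : (\int[mu]_y `|(EFin \o h) y| = \int[mu]_(y in ball x d) `|(EFin \o h) y|)%E.
  rewrite [RHS]integral_mkcond; apply: eq_integral => y _; rewrite patchE.
  case: ifPn => //; rewrite notin_setE /ball/= => /negP; rewrite -leNgt => dxy.
  by rewrite /h tri_out// !mulr0 subrr normr0.
rewrite /davg /iavg (lebesgue_measure_ball _ d0').
apply: (@le_trans _ _ (\int[mu]_(y in ball x d) (d%:E * `|((center (g x) \o g) y)%:E|))%E).
  apply: ge0_le_integral => //.
  - by apply: measurableT_comp => //; apply/measurable_EFinP/measurable_funTS.
  - apply: emeasurable_funM => //; apply: measurableT_comp => //.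
    apply/measurable_EFinP/measurable_funTS/measurable_funB => //.
  - move=> y _; rewrite lee_fin /h -mulrBl normrM mulrC ler_wpM2r//.
    by rewrite ger0_norm ?tri_ge0// tri_le.
rewrite ge0_integralZl//; last first.
  apply: measurableT_comp => //; apply/measurable_EFinP/measurable_funTS.
  exact: measurable_funB.
rewrite inver mulrn_eq0/= gt_eqF// muleA -EFinM.
have -> : 2 * d ^+ 2 / (d *+ 2) = d by rewrite -mulr_natr; field; rewrite gt_eqF.
by [].
Qed.

Lemma tri_average g x : L1 g -> lebesgue_pt g x -> forall e, 0 < e ->
  \forall d \near 0^'+, `|\int[mu]_y (g y * triangle d (x - y)) - d ^+ 2 * g x| <= e * d ^+ 2.
Proof.
move=> ig gx e e0.
have /(_ (e / 2)%:E) : forall z, (0 < z)%E -> \forall d \near 0^'+, (davg g x d < z)%E.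
  by move=> z z0; exact: (gx _ (open_ereal_lt' z0)).
rewrite lte_fin divr_gt0// => /(_ isT) H.
near=> d.
have d0 : 0 < d by [].
rewrite -lee_fin; apply: (le_trans (tri_davg x ig d0)).
apply: (@le_trans _ _ ((2 * d ^+ 2)%:E * (e / 2)%:E)%E).
  by rewrite lee_wpmul2l ?lee_fin ?mulr_ge0 ?sqr_ge0//; apply/ltW; near: d.
by rewrite -EFinM lee_fin le_eqVlt; apply/orP; left; apply/eqP; field.
Unshelve. all: by end_near. Qed.

Lemma tri_bound_ae g A : L1 g ->
  (forall d x, 0 <= d -> `|\int[mu]_y (g y * triangle d (x - y))| <= d ^+ 2 * A) ->
  {ae mu, forall x, `|g x| <= A}.
Proof.
move=> ig gA; have := L1_lebesgue_pt ig.
apply: filterS; first exact: (ae_filter_ringOfSetsType mu).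
move=> x gx.
apply/ler_addgt0Pr => e e0.
have : \forall d \near (0:R)^'+, `|g x| <= A + e.
  near=> d.
  have d0 : 0 < d by [].
  have h1 := gA d x (ltW d0).
  have h2 : `|\int[mu]_y (g y * triangle d (x - y)) - d ^+ 2 * g x| <= e * d ^+ 2.
    by near: d; exact: tri_average.
  have d2 : 0 < d ^+ 2 by rewrite exprn_gt0.
  rewrite -(ler_pM2l d2) -{1}(ger0_norm (ltW d2)) -normrM.
  have := ler_distD (\int[mu]_y (g y * triangle d (x - y))) 0 (d ^+ 2 * g x).
  by rewrite !sub0r !normrN; lra.
by move=> /filter_ex[].
Unshelve. all: by end_near. Qed.

End LebesguePoints.

(** * The complex Fourier transform and its weighted supremum *)

Section ComplexTransform.
Variable R : realType.
Local Notation mu := (@lebesgue_measure R).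
Notation L1 g := (mu.-integrable setT (EFin \o g)).
Local Notation normc := ComplexField.Normc.normc.
Implicit Types (u : R -> R[i]) (x y d w xi : R).

(** A nonempty open set is not negligible; this turns essential suprema of
continuous functions into suprema. *)
Lemma ae_le_continuous (h : R -> R) M : continuous h ->
  {ae mu, forall x, h x <= M} -> forall x, h x <= M.
Proof.
move=> ch [N [mN N0 hN]] x; rewrite leNgt; apply/negP => Mx.
have : \forall y \near x, M < h y.
  by have := cvgr_gt (h x) (ch x); apply.
move=> /nbhs_ballP[e /= e0 eh].
have : (mu (ball x e) <= mu N)%E.
  apply: le_measure; rewrite ?inE//; first exact: measurable_ball.
  by move=> y xy; apply: hN => /=; apply/negP; rewrite -ltNge; exact: eh.
rewrite N0 lebesgue_measure_ball; last exact: ltW.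
by rewrite lee_fin leNgt pmulrn_lgt0// e0.
Qed.

Lemma normc_ReIm (z : R[i]) :
  normc z = Num.sqrt (complex.Re z ^+ 2 + complex.Im z ^+ 2).
Proof. by case: z. Qed.

Lemma normc_ge0 (z : R[i]) : 0 <= normc z.
Proof. by rewrite normc_ReIm sqrtr_ge0. Qed.

Lemma normRe_le (z : R[i]) : `|complex.Re z| <= normc z.
Proof. by rewrite normc_ReIm -sqrtr_sqr ler_wsqrtr// lerDl sqr_ge0. Qed.

Lemma normIm_le (z : R[i]) : `|complex.Im z| <= normc z.
Proof. by rewrite normc_ReIm -sqrtr_sqr ler_wsqrtr// lerDr sqr_ge0. Qed.

Lemma normc_le (z : R[i]) : normc z <= `|complex.Re z| + `|complex.Im z|.
Proof.
rewrite normc_ReIm -[leRHS]ger0_norm ?addr_ge0// -sqrtr_sqr ler_wsqrtr//.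
rewrite sqrrD !real_normK ?num_real// -addrA addrCA addrC lerDl.
by rewrite mulrn_wge0// mulr_ge0.
Qed.

Lemma normc_real_scale (z : R[i]) (a : R) : 0 <= a -> normc (z * a%:C) = normc z * a.
Proof.
move=> a0; case: z => p q; rewrite !normc_ReIm /= !mulr0 subr0 add0r.
by rewrite !exprMn -mulrDl sqrtrM ?addr_ge0 ?sqr_ge0// sqrtr_sqr ger0_norm.
Qed.

Section Transform.
Variable u : R -> R[i].
Hypothesis iu : inL1 u.
Let p x := complex.Re (u x).
Let q x := complex.Im (u x).

Lemma L1_Re : L1 p. Proof. by case: iu. Qed.
Lemma L1_Im : L1 q. Proof. by case: iu. Qed.

Lemma fourier_Re xi :
  complex.Re (fourier u xi) = cosT p (2 * pi * xi) + sinT q (2 * pi * xi).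
Proof.
rewrite /fourier /cintegral /= /cosT /sinT -RintegralD//.
- apply: eq_Rintegral => x _; rewrite /expi /p /q.
  by case: (u x) => a b /=; rewrite cosN sinN mulrN opprK.
- exact/L1_cos/L1_Re.
- exact/L1_sin/L1_Im.
Qed.

Lemma fourier_Im xi :
  complex.Im (fourier u xi) = cosT q (2 * pi * xi) - sinT p (2 * pi * xi).
Proof.
rewrite /fourier /cintegral /= /cosT /sinT -RintegralB//.
- apply: eq_Rintegral => x _; rewrite /expi /p /q.
  by case: (u x) => a b /=; rewrite cosN sinN mulrN addrC.
- exact/L1_cos/L1_Im.
- exact/L1_sin/L1_Re.
Qed.

Lemma continuous_normc_fourier :
  continuous (fun xi => normc (mulsq (fourier u) xi)).
Proof.
have -> : (fun xi => normc (mulsq (fourier u) xi)) =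
   (fun xi => Num.sqrt ((cosT p (2 * pi * xi) + sinT q (2 * pi * xi)) ^+ 2 +
              (cosT q (2 * pi * xi) - sinT p (2 * pi * xi)) ^+ 2) * `|xi| ^+ 2).
  apply: funext => xi; rewrite /mulsq normc_real_scale ?exprn_ge0//.
  by rewrite normc_ReIm fourier_Re fourier_Im.
have cl : continuous (fun xi : R => 2 * pi * xi) by exact: mulrl_continuous.
have c1 : continuous (fun xi => cosT p (2 * pi * xi) + sinT q (2 * pi * xi)).
  apply: contD; apply: cont_comp cl; first exact: (continuous_cosT L1_Re).
  exact: (continuous_sinT L1_Im).
have c2 : continuous (fun xi => cosT q (2 * pi * xi) - sinT p (2 * pi * xi)).
  apply: contB; apply: cont_comp cl; first exact: (continuous_cosT L1_Im).
  exact: (continuous_sinT L1_Re).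
apply: contM; last by apply: contM; exact: norm_continuous.
by apply: (cont_comp (@sqrt_continuous R)); apply: contD; exact: contM.
Qed.

(** The transform of an integrable function is continuous, so that its weighted
essential supremum is a genuine supremum. *)
Lemma cnorm_fourier_leP (M : R) :
  (cnorm +oo (mulsq (fourier u)) <= M%:E)%E <->
  forall xi, normc (fourier u xi) * xi ^+ 2 <= M.
Proof.
have muT : (0 < mu setT)%E.
  apply: (@lt_le_trans _ _ (mu (ball (0:R) 1))).
    by rewrite lebesgue_measure_ball// lte_fin pmulrn_lgt0.
  by apply: le_measure; rewrite ?inE//; exact: measurable_ball.
have E xi : normc (mulsq (fourier u) xi) = normc (fourier u xi) * xi ^+ 2.
  by rewrite /mulsq normc_real_scale ?exprn_ge0// real_normK ?num_real.
rewrite /cnorm unlock muT; split => [/ess_supP h|h].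
  move=> xi; rewrite -E; apply: (ae_le_continuous continuous_normc_fourier).
  by apply: filterS h => y /=; rewrite lee_fin ger0_norm ?normc_ge0.
apply/ess_supP; apply: nearW => x.
by have := h x; rewrite -E -lee_fin -{1}(ger0_norm (normc_ge0 _)).
Qed.

Lemma L1_normc : L1 (fun x => normc (u x)).
Proof.
apply: (@L1_le _ _ (fun x => `|p x| + `|q x|)).
- have -> : (fun x => normc (u x)) = Num.sqrt \o (fun x => p x ^+ 2 + q x ^+ 2).
    by apply: funext => x; rewrite normc_ReIm.
  apply: (measurableT_comp (continuous_measurable_fun (@sqrt_continuous R))).
  apply: measurable_funD; apply: measurable_funX; apply: integrable_measurable.
    exact: L1_Re.
  exact: L1_Im.
- by apply: L1D; apply: L1_norm; [exact: L1_Re|exact: L1_Im].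
- move=> x; rewrite ger0_norm ?normc_ge0// ger0_norm ?addr_ge0//.
  exact: normc_le.
Qed.

Lemma cnorm1E : cnorm 1 u = (\int[mu]_x normc (u x))%:E.
Proof.
rewrite /cnorm Lnorm1 /Rintegral fineK.
  by apply: eq_integral => x _ /=; rewrite ger0_norm ?normc_ge0.
exact: (integrable_fin_num measurableT L1_normc).
Qed.

End Transform.
End ComplexTransform.

(** * The uncertainty inequality *)

Section Uncertainty.
Variable R : realType.
Local Notation mu := (@lebesgue_measure R).
Notation L1 g := (mu.-integrable setT (EFin \o g)).
Local Notation normc := ComplexField.Normc.normc.
Variable u : R -> R[i].
Hypothesis iu : inL1 u.
Let p x := complex.Re (u x).
Let q x := complex.Im (u x).
Let N := \int[mu]_x normc (u x).
Implicit Types (x y d w xi S T : R).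

Lemma cosTN (g : R -> R) w : cosT g (- w) = cosT g w.
Proof. by apply: eq_Rintegral => x _; rewrite mulNr cosN. Qed.

Lemma sinTN (g : R -> R) w : L1 g -> sinT g (- w) = - sinT g w.
Proof.
move=> ig; rewrite /sinT -[RHS]mulN1r -RintegralZl//; last exact: L1_sin.
by apply: eq_Rintegral => x _; rewrite mulNr sinN mulrN mulN1r.
Qed.

Let ip : L1 p. Proof. exact: (L1_Re iu). Qed.
Let iq : L1 q. Proof. exact: (L1_Im iu). Qed.

(** The cosine and sine transforms of the real and imaginary parts of u are the even
and odd parts of the components of its Fourier transform. *)
Lemma transforms_le (M : R) :
  (forall xi, normc (fourier u xi) * xi ^+ 2 <= M) ->
  [/\ forall xi, `|cosT p (2 * pi * xi)| * xi ^+ 2 <= M,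
      forall xi, `|sinT p (2 * pi * xi)| * xi ^+ 2 <= M,
      forall xi, `|cosT q (2 * pi * xi)| * xi ^+ 2 <= M &
      forall xi, `|sinT q (2 * pi * xi)| * xi ^+ 2 <= M].
Proof.
move=> uM.
have key xi (a b c : R) : `|b| <= normc (fourier u xi) ->
    `|c| <= normc (fourier u (- xi)) -> 2 * a = b + c -> `|a| * xi ^+ 2 <= M.
  move=> hb hc E; have h1 := uM xi; have := uM (- xi); rewrite sqrrN => h2.
  have x2 := sqr_ge0 xi.
  have h : 2 * `|a| <= normc (fourier u xi) + normc (fourier u (- xi)).
    rewrite -[2]ger0_norm// -normrM E; apply: (le_trans (ler_normD _ _)).
    exact: lerD.
  have : 2 * (`|a| * xi ^+ 2) <=
      normc (fourier u xi) * xi ^+ 2 + normc (fourier u (- xi)) * xi ^+ 2.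
    by rewrite mulrA -mulrDl; apply: ler_wpM2r.
  by lra.
have Re0 xi := fourier_Re iu xi; have Im0 xi := fourier_Im iu xi.
have neg xi : 2 * pi * - xi = - (2 * pi * xi) :> R by rewrite mulrN.
have ReN xi : complex.Re (fourier u (- xi)) = cosT p (2 * pi * xi) - sinT q (2 * pi * xi).
  by rewrite Re0 neg cosTN sinTN.
have ImN xi : complex.Im (fourier u (- xi)) = cosT q (2 * pi * xi) + sinT p (2 * pi * xi).
  by rewrite Im0 neg cosTN sinTN// opprK.
split => xi.
- apply: (key xi _ (complex.Re (fourier u xi)) (complex.Re (fourier u (- xi)))).
  + exact: normRe_le.
  + exact: normRe_le.
  + by rewrite Re0 ReN; ring.
- apply: (key xi _ (- complex.Im (fourier u xi)) (complex.Im (fourier u (- xi)))).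
  + by rewrite normrN; exact: normIm_le.
  + exact: normIm_le.
  + by rewrite Im0 ImN; ring.
- apply: (key xi _ (complex.Im (fourier u xi)) (complex.Im (fourier u (- xi)))).
  + exact: normIm_le.
  + exact: normIm_le.
  + by rewrite Im0 ImN; ring.
- apply: (key xi _ (complex.Re (fourier u xi)) (- complex.Re (fourier u (- xi)))).
  + exact: normRe_le.
  + by rewrite normrN; exact: normRe_le.
  + by rewrite Re0 ReN; ring.
Qed.

Lemma intRe_le : \int[mu]_x `|p x| <= N.
Proof.
apply: le_Rintegral => //; [exact: L1_norm|exact: (L1_normc iu)|].
by move=> x _; exact: normRe_le.
Qed.

Lemma intIm_le : \int[mu]_x `|q x| <= N.
Proof.
apply: le_Rintegral => //; [exact: L1_norm|exact: (L1_normc iu)|].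
by move=> x _; exact: normIm_le.
Qed.

(** Here A is any bound for the infimum over S of the constants of Rintegral_tri_le.
Taking the infimum before passing to almost every x makes the degenerate case
M = 0 accessible. *)
Lemma normc_bound_ae (M A : R) : 0 <= M ->
  (forall xi, normc (fourier u xi) * xi ^+ 2 <= M) ->
  (forall e : R, 0 < e -> exists2 S, 0 < S & 5 * S * N + 4 * M / S <= A + e) ->
  {ae mu, forall x, normc (u x) <= 2 * A}.
Proof.
move=> M0 /transforms_le[cp sp cq sq] SA.
have tri_le (g : R -> R) : L1 g -> \int[mu]_x `|g x| <= N ->
    (forall xi, `|cosT g (2 * pi * xi)| * xi ^+ 2 <= M) ->
    (forall xi, `|sinT g (2 * pi * xi)| * xi ^+ 2 <= M) ->
    forall d x, 0 <= d -> `|\int[mu]_y (g y * triangle d (x - y))| <= d ^+ 2 * A.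
  move=> ig gN cM sM d x d0; apply/ler_addgt0Pr => e e0.
  (* e / (d^2 + 1) instead of e / d^2, which is undefined at d = 0 *)
  have d1 : 0 < d ^+ 2 + 1 by rewrite ltr_wpDl ?sqr_ge0.
  have [S S0 hS] := SA _ (divr_gt0 e0 d1).
  apply: (le_trans (Rintegral_tri_le ig gN M0 S0 cM sM x d0)).
  apply: (le_trans (ler_wpM2l (sqr_ge0 d) hS)).
  rewrite mulrDr lerD2l mulrCA ler_piMr ?(ltW e0)//.
  by rewrite ler_pdivrMr// mul1r lerDl.
have hp := tri_bound_ae ip (tri_le _ ip intRe_le cp sp).
have hq := tri_bound_ae iq (tri_le _ iq intIm_le cq sq).
move: hp hq; apply: filterS2; first exact: (ae_filter_ringOfSetsType mu).
move=> x px qx; apply: (le_trans (normc_le _)); rewrite mulr2n mulrDl mul1r.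
exact: lerD.
Qed.

Let V := cnorm 1 (mulsq u).

Lemma cnorm1_mulsqE : V = (\int[mu]_x (normc (u x) * x ^+ 2)%:E)%E.
Proof.
rewrite /V /cnorm Lnorm1; apply: eq_integral => x _.
rewrite /mulsq normc_real_scale ?exprn_ge0// real_normK ?num_real//.
by rewrite gee0_abs// lee_fin mulr_ge0 ?normc_ge0 ?sqr_ge0.
Qed.

Lemma measurable_mulsq : measurable_fun setT (fun x => normc (u x) * x ^+ 2).
Proof.
apply: measurable_funM; first exact: (integrable_measurable (L1_normc iu)).
exact: measurable_funX.
Qed.

Lemma V_ge0 : (0 <= V)%E. Proof. exact: Lnorm_ge0. Qed.

(** The mass in [-T, T] is controlled by the height A, the mass outside by the second
moment, since 1 <= x^2 / T^2 there. *)
Lemma mass_le (A T : R) : 0 <= A -> 0 < T -> {ae mu, forall x, normc (u x) <= A} ->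
  (N%:E <= (2 * T * A)%:E + (T ^- 2)%:E * V)%E.
Proof.
move=> A0 T0 uA; rewrite -(cnorm1E iu) /cnorm Lnorm1 cnorm1_mulsqE.
have T2 : 0 < T ^- 2 by rewrite invr_gt0 exprn_gt0.
have mm := measurable_mulsq.
have vge0 x : (0 <= (normc (u x) * x ^+ 2)%:E)%E.
  by rewrite lee_fin mulr_ge0 ?normc_ge0 ?sqr_ge0.
rewrite -ge0_integralZl_EFin//; last 2 first.
- exact/measurable_EFinP.
- exact: ltW.
have -> : (2 * T * A)%:E =
    (\int[mu]_x (A%:E * (\1_(`[- T, T]%classic) x)%:E))%E.
  rewrite ge0_integralZl_EFin//; last first.
    by apply/measurable_EFinP; exact: measurable_indic.
  rewrite integral_indic// setIT [X in (_ * X)%E](_ : _ = (2 * T)%:E).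
    by rewrite -EFinM mulrC.
  by apply: etrans (lebesgue_measure_itv _) _;
    rewrite /= lte_fin gtrN// -EFinD opprK mulr2n mulrDl mul1r.
rewrite -ge0_integralD//; last 4 first.
- by move=> x _; rewrite mule_ge0// lee_fin.
- by apply: emeasurable_funM => //; apply/measurable_EFinP; exact: measurable_indic.
- by move=> x _; rewrite mule_ge0// lee_fin ltW.
- by apply: emeasurable_funM => //; exact/measurable_EFinP.
apply: ae_ge0_le_integral => //.
- apply: measurableT_comp => //; apply/measurable_EFinP.
  exact: (integrable_measurable (L1_normc iu)).
- by move=> x _; rewrite adde_ge0// mule_ge0// lee_fin// ltW.
- apply: emeasurable_funD; apply: emeasurable_funM => //; apply/measurable_EFinP => //.
move: uA; apply: filterS; first exact: (ae_filter_ringOfSetsType mu).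
move=> x ux _; rewrite gee0_abs ?lee_fin ?normc_ge0//.
suff H : normc (u x) <= A * \1_(`[- T, T]%classic) x + T ^- 2 * (normc (u x) * x ^+ 2).
  by move: H; rewrite -lee_fin.
have u0 := normc_ge0 (u x).
rewrite indicE; case: (boolP (x \in _)) => [_|].
  rewrite mulr1; apply: (le_trans ux); rewrite lerDl mulr_ge0 ?(ltW T2)//.
  by rewrite mulr_ge0 ?sqr_ge0.
rewrite notin_setE /= in_itv/= => /negP/negP xT; rewrite mulr0 add0r mulrCA.
apply: ler_peMr => //; rewrite ler_pdivlMl ?exprn_gt0// mulr1.
rewrite -[leRHS]real_normK ?num_real// ler_sqr ?nnegrE ?(ltW T0)//.
by rewrite leNgt; apply/negP => xT'; move: xT; rewrite -ler_norml (ltW xT').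
Qed.

(** Excludes the product 0 * +oo when the transform is unbounded. *)
Lemma mass_eq0 : V = 0%E -> N = 0.
Proof.
rewrite cnorm1_mulsqE => V0.
have mm := measurable_mulsq.
have h : ae_eq mu setT (fun x => (normc (u x) * x ^+ 2)%:E) (cst 0%E).
  apply/ae_eq_integral_abs => //; first exact/measurable_EFinP.
  rewrite -[RHS]V0; apply: eq_integral => x _; rewrite gee0_abs//.
  by rewrite lee_fin mulr_ge0 ?normc_ge0 ?sqr_ge0.
have x0 : {ae mu, forall x, x != 0}.
  exists [set 0]; split => //; first exact: lebesgue_measure_set1.
  by move=> x /= /negP; rewrite negbK => /eqP.
have u0 : ae_eq mu setT (fun x => (normc (u x))%:E) (cst 0%E).
  apply: filterS2 h x0 => x /(_ I)/= [] /eqP h x0 _; congr EFin; apply/eqP.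
  by move: h; rewrite mulf_eq0 sqrf_eq0 (negbTE x0) orbF.
rewrite /N /Rintegral (@ge0_ae_eq_integral _ _ _ mu setT _ (cst 0%E))//.
- by rewrite integral0.
- by apply/measurable_EFinP; exact: (integrable_measurable (L1_normc iu)).
- by move=> x _; rewrite lee_fin normc_ge0.
Qed.

Lemma N_ge0 : 0 <= N.
Proof. by apply: Rintegral_ge0 => x _; exact: normc_ge0. Qed.

(** Excludes the product 0 * +oo when the second moment is infinite. *)
Lemma sup_eq0 : (forall xi, normc (fourier u xi) * xi ^+ 2 <= 0) -> N = 0.
Proof.
move=> u0; have N0 := N_ge0.
have h : {ae mu, forall x, normc (u x) <= 2 * 0}.
  apply: (@normc_bound_ae 0) => // e e0.
  have N1 : 0 < 5 * N + 1 by rewrite ltr_wpDl ?mulr_ge0.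
  (* 5 * N + 1 instead of 5 * N, which may vanish *)
  exists (e / (5 * N + 1)); first exact: divr_gt0.
  rewrite mulr0 mul0r addr0 add0r.
  rewrite (_ : 5 * _ * N = e * (5 * N) / (5 * N + 1)); last by ring.
  rewrite ler_pdivrMr//; apply: ler_wpM2l; first exact: ltW.
  by rewrite lerDl.
apply: le_anti; rewrite N0 andbT -lee_fin /N -(cnorm1E iu) /cnorm Lnorm1.
apply: (@le_trans _ _ (\int[mu]_x (cst 0 x))%E); last by rewrite integral0.
apply: ae_ge0_le_integral => //.
- apply: measurableT_comp => //; apply/measurable_EFinP.
  exact: (integrable_measurable (L1_normc iu)).
move: h; apply: filterS; first exact: (ae_filter_ringOfSetsType mu).
by move=> x + _; rewrite mulr0 gee0_abs ?lee_fin ?normc_ge0.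
Qed.

Lemma mass_le_real (M v : R) : 0 <= M -> V = v%:E -> 0 < N ->
  (forall xi, normc (fourier u xi) * xi ^+ 2 <= M) -> N ^+ 2 <= 64 * 160 * (M * v).
Proof.
move=> M0 Vv N0 uM.
have v0 : 0 < v.
  rewrite lt_neqAle -lee_fin -Vv V_ge0 andbT eq_sym; apply/eqP => v0.
  by move: N0; rewrite mass_eq0 ?ltxx// Vv v0.
(* this T makes the tail v / T^2 equal to N / 4, and S = 1 / (40 T) makes the
   term 20 T S N equal to N / 2 *)
pose t := 4 * v / N; have t0 : 0 < t by rewrite divr_gt0// mulr_gt0.
pose T := Num.sqrt t; have T0 : 0 < T by rewrite sqrtr_gt0.
have T2 : T ^+ 2 = t by rewrite sqr_sqrtr// ltW.
pose S := (40 * T)^-1; have S0 : 0 < S by rewrite invr_gt0 mulr_gt0.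
pose A := 5 * S * N + 4 * M / S.
have A0 : 0 <= A.
  by rewrite addr_ge0 ?divr_ge0 ?mulr_ge0 ?(ltW S0) ?(ltW N0).
have h : {ae mu, forall x, normc (u x) <= 2 * A}.
  by apply: (normc_bound_ae M0 uM) => e e0; exists S => //; rewrite lerDl ltW.
have := mass_le (mulr_ge0 (ler0n R 2) A0) T0 h; rewrite Vv -EFinM -EFinD lee_fin.
have -> : 2 * T * (2 * A) = N / 2 + 640 * M * T ^+ 2.
  by rewrite /A /S; field; rewrite gt_eqF.
rewrite T2 /t.
have -> : (4 * v / N)^-1 * v = N / 4 by field; rewrite !gt_eqF.
have -> : 640 * M * (4 * v / N) = 4 * (640 * (M * v)) / N by ring.
move=> H; have {}H : N / 4 <= 4 * (640 * (M * v)) / N by lra.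
by move: H; rewrite ler_pdivlMr// expr2; lra.
Qed.

Theorem uncertainty_ge :
  (((64 * 160) ^- 2)%:E * cnorm 1 u ^+ 4 <= uncertainty u)%E.
Proof.
have N0 := N_ge0; rewrite /uncertainty (cnorm1E iu) -/N -/V.
have M0 : (0 <= cnorm +oo (mulsq (fourier u)))%E by exact: Lnorm_ge0.
move: N0; rewrite le_eqVlt => /predU1P[<-|N0].
  by rewrite -EFin_expe expr0n mule0 mule_ge0// expe_ge0// V_ge0.
have V0 : (0 < V)%E.
  rewrite lt_neqAle V_ge0 andbT eq_sym; apply/eqP => v0.
  by move: N0; rewrite mass_eq0 ?ltxx.
move: M0 (cnorm_fourier_leP iu); case: (cnorm +oo _) => [M|_ _|//]; last first.
  by rewrite expe2 mulyy gt0_mulye ?leey// expe_gt0.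
rewrite lee_fin => M0 /(_ M)[/(_ (lexx _)) uM _].
have Mpos : 0 < M.
  rewrite lt_neqAle M0 andbT eq_sym; apply/eqP => M00.
  by move: N0; rewrite sup_eq0 ?ltxx// -M00.
case E : V V0 => [v||//]; last first.
  by move=> _; rewrite [(+oo ^+ 2)%E]expe2 mulyy gt0_muley ?leey// expe_gt0.
rewrite lte_fin => v0; rewrite -!EFin_expe -!EFinM lee_fin.
have := mass_le_real M0 E N0 uM.
have : 0 < 64 * 160 :> R by rewrite mulr_gt0.
move: (64 * 160 : R) => K K0 H.
have : N ^+ 2 ^+ 2 <= (K * (M * v)) ^+ 2.
  by rewrite ler_sqr ?nnegrE ?sqr_ge0// mulr_ge0 ?mulr_ge0// ltW.
rewrite -exprM exprMn -[X in _ <= X -> _]mulrC -ler_pdivrMr ?exprn_gt0//.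
by rewrite exprMn mulrC.
Qed.

End Uncertainty.

(** * Smooth functions supported in [-1, 1] *)

Section SmoothFunction.
Variable R : realType.
Local Notation mu := (@lebesgue_measure R).
Notation L1 g := (mu.-integrable setT (EFin \o g)).
Implicit Types (f g h : R -> R) (w x y xi : R).

Lemma derive1_out h : (forall x, 1 < `|x| -> h x = 0) ->
  forall x, 1 < `|x| -> derive1 h x = 0.
Proof.
move=> h0 x x1; rewrite derive1E.
have : \forall y \near x, h y = cst 0 y.
  have : \forall y \near x, 1 < `|y| by have := cvgr_gt `|x| (@norm_continuous _ R x); apply.
  by apply: filterS => y /h0.
by move=> /near_eq_derive ->; rewrite derive_cst.
Qed.

(** The boundary points 1 and -1 are limits of points outside [-1, 1]. *)
Lemma continuous_out h : continuous h -> (forall x, 1 < `|x| -> h x = 0) ->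
  forall x, 1 <= `|x| -> h x = 0.
Proof.
move=> ch h0 x; rewrite le_eqVlt => /predU1P[x1|]; last exact: h0.
apply/eqP/negPn/negP => hx.
have : \forall y \near x, h y != 0 by apply: (cvgr_neq0 _ (ch x)).
move=> /nbhs_ballP[e /= e0 he].
have e2 : 0 < e / 2 by rewrite divr_gt0.
have := he (x * (1 + e / 2)).
have x0 : `|x| * (e / 2) < e by rewrite -x1 mul1r ltr_pdivrMr// ltr_pMr// ltr1n.
rewrite /ball /= mulrDr mulr1 opprD addrA subrr sub0r normrN normrM.
rewrite (ger0_norm (ltW e2)) => /(_ x0); apply/negP; rewrite negbK; apply/eqP.
apply: h0; rewrite -{1}(mulr1 x) -mulrDr normrM -x1 mul1r ger0_norm; lra.
Qed.

Lemma supp11 h : (forall x, 1 <= `|x| -> h x = 0) ->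
  forall x, ~~ (-1 <= x <= 1) -> h x = 0.
Proof.
by move=> h0 x; rewrite -ler_norml -ltNge => /ltW; exact: h0.
Qed.

(** The form in which integration by parts is used below: the boundary terms at 1 and
-1 vanish. *)
Lemma Rintegral_derive_supp (H h : R -> R) : (forall x : R, is_derive x 1 H (h x)) ->
  continuous h -> (forall x, 1 < `|x| -> h x = 0) -> H 1 = 0 -> H (-1) = 0 ->
  \int[mu]_x h x = 0.
Proof.
move=> dH ch h0 H1 HN1.
rewrite (@Rintegral_supp _ _ (-1) 1); last by apply/supp11/continuous_out.
by rewrite (Rintegral_FTC2 _ dH ch) ?H1 ?HN1 ?subrr//; lra.
Qed.

Lemma abs_cosB_le (a b : R) : `|cos a - cos b| <= `|a - b|.
Proof.
wlog ab : a b / b <= a => [H|].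
  by have /orP[/H//|ba] := le_total b a; rewrite (distrC (cos a)) (distrC a); exact: H.
rewrite [leRHS]ger0_norm ?subr_ge0// -[leRHS]mul1r.
apply: (@mean_value_le _ _ (fun x => - sin x)) => // y _.
by rewrite normrN sin_max.
Qed.

Section Facts.
Variable f : R -> R.
Hypothesis fC : classC 3 f.
Hypothesis fsupp : forall x, 1 < `|x| -> f x = 0.
Let f1 := derive1 f.
Let f2 := derive1 f1.
Let f3 := derive1 f2.

Lemma is_derive_f (x : R) : is_derive x 1 f (f1 x).
Proof.
have : derivable f x 1 := fC.1 0%N isT x.
by rewrite /f1 derive1E => /derivableP.
Qed.
Lemma is_derive_f1 (x : R) : is_derive x 1 f1 (f2 x).
Proof.
have : derivable f1 x 1 := fC.1 1%N isT x.
by rewrite /f2 derive1E => /derivableP.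
Qed.
Lemma is_derive_f2 (x : R) : is_derive x 1 f2 (f3 x).
Proof.
have : derivable f2 x 1 := fC.1 2%N isT x.
by rewrite /f3 derive1E => /derivableP.
Qed.
Lemma continuous_f3 : continuous f3.
Proof. exact: fC.2. Qed.
Lemma continuous_f : continuous f. Proof. exact: is_derive_continuous is_derive_f. Qed.
Lemma continuous_f1 : continuous f1. Proof. exact: is_derive_continuous is_derive_f1. Qed.
Lemma continuous_f2 : continuous f2. Proof. exact: is_derive_continuous is_derive_f2. Qed.

Lemma f1_out x : 1 < `|x| -> f1 x = 0. Proof. exact: derive1_out. Qed.
Lemma f2_out x : 1 < `|x| -> f2 x = 0. Proof. exact: (derive1_out (@f1_out)). Qed.
Lemma f3_out x : 1 < `|x| -> f3 x = 0. Proof. exact: (derive1_out (@f2_out)). Qed.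

Lemma f_out x : 1 <= `|x| -> f x = 0. Proof. exact: (continuous_out (@continuous_f) fsupp). Qed.
Lemma f1_out' x : 1 <= `|x| -> f1 x = 0.
Proof. exact: (continuous_out (@continuous_f1) (@f1_out)). Qed.
Lemma f2_out' x : 1 <= `|x| -> f2 x = 0.
Proof. exact: (continuous_out (@continuous_f2) (@f2_out)). Qed.

Lemma L1_supp11 h : continuous h -> (forall x, 1 < `|x| -> h x = 0) -> L1 h.
Proof. by move=> ch h0; apply: (L1_supp ch); apply/supp11/continuous_out. Qed.

Lemma L1_f : L1 f. Proof. exact: (L1_supp11 (@continuous_f) fsupp). Qed.
Lemma L1_f2 : L1 f2. Proof. exact: (L1_supp11 (@continuous_f2) (@f2_out)). Qed.
Lemma L1_f3 : L1 f3. Proof. exact: (L1_supp11 (@continuous_f3) (@f3_out)). Qed.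

Lemma continuous_cosM w : continuous (fun x : R => cos (w * x)).
Proof. by have := @continuous_cosMr R w; under eq_fun do rewrite mulrC. Qed.

Lemma continuous_sinM w : continuous (fun x : R => sin (w * x)).
Proof. by have := @continuous_sinMr R w; under eq_fun do rewrite mulrC. Qed.

Let one1 : 1 <= `|1 : R|. Proof. by rewrite normr1. Qed.
Let one1N : 1 <= `|- 1 : R|. Proof. by rewrite normrN1. Qed.

Lemma cosT_f2E w : w ^+ 2 * cosT f w = - cosT f2 w.
Proof.
apply/eqP; rewrite -addr_eq0; apply/eqP.
have i1 : L1 (fun x => w ^+ 2 * (f x * cos (w * x))) by exact/L1Z/L1_cos/L1_f.
rewrite /cosT -RintegralZl//; last exact/L1_cos/L1_f.
rewrite -RintegralD//; last exact/L1_cos/L1_f2.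
apply: (@Rintegral_derive_supp (fun x => w * (f x * sin (w * x)) + f1 x * cos (w * x))).
- move=> x; have ? := is_derive_f x; have ? := is_derive_f1 x.
  by apply: is_derive_eq; rewrite /GRing.scale/=; ring.
- apply: contD; first apply: contM; first exact: cst_continuous.
    by apply: contM; [exact: continuous_f|exact: continuous_cosM].
  by apply: contM; [exact: continuous_f2|exact: continuous_cosM].
- by move=> x x1; rewrite fsupp// f2_out// !mul0r mulr0 addr0.
- by rewrite f_out// f1_out'// !mul0r mulr0 addr0.
- by rewrite f_out// f1_out'// !mul0r mulr0 addr0.
Qed.

(** One more integration by parts than in cosT_f2E: it makes |xi|^2 f^(xi) decay at
infinity, which is where three derivatives of f are used. *)
Lemma cosT_f3E w : w * cosT f2 w = - sinT f3 w.
Proof.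
apply/eqP; rewrite -addr_eq0; apply/eqP.
have i1 : L1 (fun x => w * (f2 x * cos (w * x))) by exact/L1Z/L1_cos/L1_f2.
rewrite /cosT /sinT -RintegralZl//; last exact/L1_cos/L1_f2.
rewrite -RintegralD//; last exact/L1_sin/L1_f3.
apply: (@Rintegral_derive_supp (fun x => f2 x * sin (w * x))).
- move=> x; have ? := is_derive_f2 x.
  by apply: is_derive_eq; rewrite /GRing.scale/=; ring.
- apply: contD; first apply: contM; first exact: cst_continuous.
    by apply: contM; [exact: continuous_f2|exact: continuous_cosM].
  by apply: contM; [exact: continuous_f3|exact: continuous_sinM].
- by move=> x x1; rewrite f2_out// f3_out// !mul0r mulr0 addr0.
- by rewrite f2_out'// mul0r.
- by rewrite f2_out'// mul0r.
Qed.

(** The factor |x| from differentiating in w is at most 1 on the support. *)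
Lemma cosT_f2_lip w w' : `|cosT f2 w - cosT f2 w'| <= `|w - w'| * \int[mu]_x `|f2 x|.
Proof.
have i2 := L1_f2.
rewrite /cosT -RintegralB//; [|exact: L1_cos|exact: L1_cos].
apply: (le_trans (le_normr_Rintegral _ _)) => //.
  by apply: L1B; exact: L1_cos.
rewrite -RintegralZl//; last exact: L1_norm.
apply: le_Rintegral => //.
- by apply: L1_norm; apply: L1B; exact: L1_cos.
- exact/L1Z/L1_norm.
move=> x _; rewrite -mulrBr normrM mulrC.
have [x1|x1] := leP `|x| 1; last by rewrite f2_out// normr0 !mulr0.
apply: ler_wpM2r => //; apply: (le_trans (abs_cosB_le _ _)).
by rewrite -mulrBl normrM ler_piMr.
Qed.

(** Since f vanishes at 1 and -1, the mean value inequality compares it with the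
distance to the boundary.  This is what keeps u0 + eps f nonnegative. *)
Lemma f_le_tri : exists2 C : R, 0 < C & forall x, `|f x| <= C * triangle 1 x.
Proof.
have [c _ cmax] : exists2 c, c \in `[(-1 : R), 1] &
    forall t, t \in `[(-1 : R), 1] -> `|f1 t| <= `|f1 c|.
  apply: (@EVT_max R (fun t => `|f1 t|)); first by lra.
  apply: continuous_subspaceT; apply: (cont_comp (@norm_continuous _ R)).
  exact: continuous_f1.
exists (`|f1 c| + 1); first by rewrite ltr_wpDl.
move=> x; have C0 : 0 <= `|f1 c| + 1 by rewrite addr_ge0.
have [x1|x1] := leP `|x| 1; last first.
  by rewrite fsupp// normr0 mulr_ge0// tri_ge0.
rewrite tri_in//.
have bnd y : -1 <= y <= 1 -> `|f1 y| <= `|f1 c| + 1.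
  by move=> y1; apply: (le_trans (cmax y _)); rewrite ?lerDl// in_itv.
move: x1; rewrite ler_norml => /andP[xl xr].
have [x0|/ltW x0] := leP 0 x.
  rewrite (ger0_norm x0).
  have := @mean_value_le R f f1 x 1 (`|f1 c| + 1) xr.
  rewrite (f_out one1) sub0r normrN; apply => y /andP[y1 y2]; first exact: is_derive_f.
  by apply: bnd; apply/andP; split; lra.
rewrite (ler0_norm x0) opprK (addrC 1).
have := @mean_value_le R f f1 (-1) x (`|f1 c| + 1) xl.
rewrite (f_out one1N) subr0 opprK; apply => y /andP[y1 y2]; first exact: is_derive_f.
by apply: bnd; apply/andP; split; lra.
Qed.

End Facts.
End SmoothFunction.

(** * The triangle u0 and its transform *)

Section Extremizer.
Variable R : realType.
Local Notation mu := (@lebesgue_measure R).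
Notation L1 g := (mu.-integrable setT (EFin \o g)).
Local Notation normc := ComplexField.Normc.normc.
Local Notation u0 := (@u0 R).
Implicit Types (g h v : R -> R) (w x y xi : R).

Lemma u0E x : u0 x = triangle 1 (0 - x).
Proof. by rewrite /triangle sub0r normrN. Qed.

Lemma continuous_u0 : continuous u0.
Proof. exact: (@continuous_tri R 1). Qed.

Lemma u0_out x : 1 < `|x| -> u0 x = 0.
Proof. by move=> x1; apply: (@tri_out R 1); exact: ltW. Qed.

Lemma L1_u0 : L1 u0.
Proof. exact: (L1_supp11 continuous_u0 (@u0_out)). Qed.

Lemma Rintegral_u0 (P P' p : R -> R) : (forall y : R, is_derive y 1 P (P' y)) ->
  (forall y : R, is_derive y 1 P' (p y)) -> continuous p ->
  \int[mu]_y (u0 y * p y) = P 1 + P (- 1) - 2 * P 0.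
Proof.
move=> dP dP' cp; have := @Rintegral_tri R P P' p 0 1 ler01 dP dP' cp.
by rewrite add0r sub0r => <-; apply: eq_Rintegral => y _; rewrite u0E.
Qed.

Lemma cosT_u0 w : w ^+ 2 * cosT u0 w = 2 - 2 * cos w.
Proof.
rewrite /cosT -RintegralZl//; last exact/L1_cos/L1_u0.
have dP (y : R) : is_derive y 1 (fun y => - cos (w * y)) (w * sin (w * y)).
  by apply: is_derive_eq; rewrite /GRing.scale/=; ring.
have dP' (y : R) : is_derive y 1 (fun y => w * sin (w * y)) (w ^+ 2 * cos (w * y)).
  by apply: is_derive_eq; rewrite /GRing.scale/=; ring.
have cp : continuous (fun y => w ^+ 2 * cos (w * y)).
  by apply: contM; [exact: cst_continuous|exact: continuous_cosM].
have := Rintegral_u0 dP dP' cp; rewrite mulr1 mulrN1 cosN mulr0 cos0 => H.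
transitivity (- cos w - cos w - 2 * -1 : R); last by ring.
by rewrite -H; apply: eq_Rintegral => y _; rewrite mulrCA.
Qed.

Lemma sinT_u0 w : sinT u0 w = 0.
Proof.
have [->|w0] := eqVneq w 0.
  by have := @sinTN R u0 0 L1_u0; rewrite oppr0; lra.
suff : w ^+ 2 * sinT u0 w = 0.
  by move/eqP; rewrite mulf_eq0 expf_eq0 (negbTE w0)/= => /eqP.
rewrite /sinT -RintegralZl//; last exact/L1_sin/L1_u0.
have dP (y : R) : is_derive y 1 (fun y => - sin (w * y)) (- (w * cos (w * y))).
  by apply: is_derive_eq; rewrite /GRing.scale/=; ring.
have dP' (y : R) : is_derive y 1 (fun y => - (w * cos (w * y))) (w ^+ 2 * sin (w * y)).
  by apply: is_derive_eq; rewrite /GRing.scale/=; ring.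
have cp : continuous (fun y => w ^+ 2 * sin (w * y)).
  by apply: contM; [exact: cst_continuous|exact: continuous_sinM].
have := Rintegral_u0 dP dP' cp; rewrite mulr1 mulrN1 sinN mulr0 sin0 => H.
transitivity (- sin w - - sin w - 2 * - 0 : R); last by ring.
by rewrite -H; apply: eq_Rintegral => y _; rewrite mulrCA.
Qed.

Lemma Rintegral_u0_1 : \int[mu]_x u0 x = 1.
Proof.
have := @Rintegral_tri1 R 0 1 ler01; rewrite expr1n => <-.
by apply: eq_Rintegral => y _; rewrite u0E.
Qed.

Lemma Rintegral_u0_sq : \int[mu]_x (u0 x * x ^+ 2) = 1 / 6.
Proof.
have dP (y : R) : is_derive y 1 (fun y : R => y ^+ 4 / 12) (y ^+ 3 / 3).
  by apply: is_derive_eq; rewrite /GRing.scale/=; field.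
have dP' (y : R) : is_derive y 1 (fun y : R => y ^+ 3 / 3) (y ^+ 2).
  by apply: is_derive_eq; rewrite /GRing.scale/=; field.
rewrite (Rintegral_u0 dP dP' (@exprn_continuous R 2)).
by field.
Qed.

Lemma sin_ge_half y : 0 <= y <= pi / 2 -> y / 2 <= sin y.
Proof.
move=> /andP[y0 ypi]; have p0 := @pi_gt0 R.
pose z := y / 2.
have z0 : 0 <= z by rewrite divr_ge0.
have [c c01 E] : exists2 c, c \in `[0, z] & sin z = cos c * z.
  have csin : {within `[0, z], continuous (@sin R)}.
    exact/continuous_subspaceT/continuous_sin.
  have [c cz] := MVT_segment z0 (fun x _ => is_derive_sin x) csin.
  by rewrite sin0 !subr0 => E; exists c.
move: c01; rewrite in_itv/= => /andP[c0 cz].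
have cc : cos z <= cos c.
  rewrite leNgt ltr_cos ?in_itv/= -?leNgt//; apply/andP; split => //.
  - by rewrite /z; lra.
  - by rewrite (le_trans cz)// /z; lra.
have cz0 : 0 <= cos z by apply: cos_ge0_pihalf; rewrite /z; apply/andP; split; lra.
have cy0 : 0 <= cos y by apply: cos_ge0_pihalf; apply/andP; split; lra.
have yz : y = z *+ 2 by rewrite /z -mulr_natr; field.
have c2 : 2^-1 <= cos z ^+ 2.
  by move: cy0; rewrite yz cos_mulr2n -mulr_natr; lra.
rewrite yz sin_mulr2n -(mulr_natr z) -(mulr_natr (cos z * sin z)) E.
have h1 : cos z * z <= cos c * z by rewrite ler_wpM2r.
have h2 : 2^-1 * z <= cos z ^+ 2 * z by rewrite ler_wpM2r.
have h3 : cos z * (cos z * z) <= cos z * (cos c * z) by rewrite ler_wpM2l.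
by rewrite mulrA -expr2 in h3; lra.
Qed.

Lemma sin_sq_ge y : `|y| <= pi / 2 -> y ^+ 2 / 4 <= sin y ^+ 2.
Proof.
move=> yp.
have -> : y ^+ 2 / 4 = (`|y| / 2) ^+ 2.
  by rewrite exprMn real_normK ?num_real//; field.
have -> : sin y ^+ 2 = sin `|y| ^+ 2.
  by case: (ger0P y) => // _; rewrite sinN sqrrN.
have h : `|y| / 2 <= sin `|y| by apply: sin_ge_half; rewrite normr_ge0.
by rewrite ler_sqr ?nnegrE ?(le_trans _ h) ?divr_ge0.
Qed.

(** Quadratic decrease of sin(pi xi)^2 away from its maxima, the half-integers. *)
Lemma sin_sq_near (k : nat) y : `|y| <= 2^-1 ->
  sin (pi * (k%:R + 2^-1 + y)) ^+ 2 <= 1 - (pi * y) ^+ 2 / 4.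
Proof.
move=> y2; have p0 := @pi_gt0 R.
have -> : pi * (k%:R + 2^-1 + y) = pi * y + pi / 2 + pi *+ k.
  by rewrite -(mulr_natl pi k); ring.
rewrite (alternatingn (@sinDpi R)) sinDpihalf exprMn -exprM mulnC exprM sqrrN expr1n.
rewrite expr1n mul1r cos2sin2 lerD2l lerN2; apply: sin_sq_ge.
by rewrite normrM (ger0_norm (ltW p0)); have := ler_wpM2l (ltW p0) y2; lra.
Qed.

End Extremizer.

(** * First-order behaviour of the functional at u0 *)

Section Perturbation.
Variable R : realType.
Local Notation mu := (@lebesgue_measure R).
Notation L1 g := (mu.-integrable setT (EFin \o g)).
Local Notation normc := ComplexField.Normc.normc.
Local Notation u0 := (@u0 R).
Implicit Types (g h v : R -> R) (w x y xi e : R).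

Section RealSignal.
Variable v : R -> R.
Hypothesis iv : L1 v.

Lemma inL1_real : inL1 (fun x => (v x)%:C).
Proof. by split => //; exact: (integrable0 mu setT). Qed.

Lemma transform0 w : cosT (fun _ => 0) w = 0 :> R /\ sinT (fun _ => 0) w = 0 :> R.
Proof.
by split; rewrite /cosT /sinT; under eq_Rintegral do rewrite mul0r;
  rewrite /Rintegral integral0.
Qed.

Lemma fourier_real xi : fourier (fun x => (v x)%:C) xi =
  cosT v (2 * pi * xi) +i* - sinT v (2 * pi * xi).
Proof.
have eta (z : R[i]) : z = complex.Re z +i* complex.Im z by case: z.
have h1 : complex.Re (fourier (fun x => (v x)%:C) xi) =
  cosT v (2 * pi * xi) + sinT (fun _ => 0) (2 * pi * xi) := fourier_Re inL1_real xi.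
have h2 : complex.Im (fourier (fun x => (v x)%:C) xi) =
  cosT (fun _ => 0) (2 * pi * xi) - sinT v (2 * pi * xi) := fourier_Im inL1_real xi.
by rewrite [LHS]eta h1 h2 (transform0 _).1 (transform0 _).2 addr0 sub0r.
Qed.
End RealSignal.

Variable f : R -> R.
Hypothesis fC : classC 3 f.
Hypothesis fsupp : forall x : R, 1 < `|x| -> f x = 0.
Hypothesis fpos : forall xi : R, 0 <= fourier (fun x => (f x)%:C) xi.

Let f2 := derive1 (derive1 f).
Let B := \int[mu]_x `|f2 x|.
Let ifL : L1 f. Proof. exact: L1_f fC fsupp. Qed.
Let if2 : L1 f2. Proof. exact: L1_f2 fC fsupp. Qed.
Let p0 : 0 < pi :> R. Proof. exact: pi_gt0. Qed.

Lemma cosT_f_ge0 xi : 0 <= cosT f (2 * pi * xi).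
Proof. by have := fpos xi; rewrite (fourier_real ifL) lecE/= => /andP[]. Qed.

Lemma sinT_f_eq0 xi : sinT f (2 * pi * xi) = 0.
Proof.
by have := fpos xi; rewrite (fourier_real ifL) lecE/= oppr_eq0 => /andP[/eqP].
Qed.

Lemma Rintegral_f_ge0 : 0 <= \int[mu]_x f x.
Proof.
have := cosT_f_ge0 0; rewrite mulr0 /cosT.
by under eq_Rintegral do rewrite mul0r cos0 mulr1.
Qed.

(** The first-order variation in the direction f of the weighted transform. *)
Definition sqhat xi : R := xi ^+ 2 * cosT f (2 * pi * xi).

Lemma sqhat_ge0 xi : 0 <= sqhat xi.
Proof. by rewrite /sqhat mulr_ge0 ?sqr_ge0 ?cosT_f_ge0. Qed.

Lemma sqhatE xi : sqhat xi = - cosT f2 (2 * pi * xi) / (4 * pi ^+ 2).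
Proof.
rewrite /sqhat -(cosT_f2E fC fsupp).
by move: (cosT f _) => c; move: (pi : R) p0 => p pp; field; rewrite gt_eqF.
Qed.

Lemma sqhatN xi : sqhat (- xi) = sqhat xi.
Proof. by rewrite /sqhat sqrrN mulrN cosTN. Qed.

Lemma sqhat_bound xi : sqhat xi <= B / (4 * pi ^+ 2).
Proof.
rewrite sqhatE; apply: ler_wpM2r; first by rewrite invr_ge0 mulr_ge0 ?sqr_ge0.
by rewrite (le_trans (ler_norm _))// normrN cosT_le.
Qed.

Lemma sqhat_lip xi xi' : sqhat xi <= sqhat xi' + B / (2 * pi) * `|xi - xi'|.
Proof.
have h := cosT_f2_lip fC fsupp (2 * pi * xi') (2 * pi * xi).
have {}h := le_trans (ler_norm _) h.
rewrite -lerBlDl !sqhatE -mulrBl opprK addrC.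
have -> : B / (2 * pi) * `|xi - xi'| = `|2 * pi * xi' - 2 * pi * xi| * B / (4 * pi ^+ 2).
  rewrite -mulrBr normrM (@ger0_norm _ (2 * pi)) ?mulr_ge0 ?(ltW p0)// distrC.
  by move: `|_ - _| => c; move: (pi : R) p0 => p pp; field; rewrite gt_eqF.
apply: ler_wpM2r; first by rewrite invr_ge0 mulr_ge0 ?sqr_ge0.
exact: h.
Qed.

Lemma sqhat_decay xi : 0 < xi -> sqhat xi <= (\int[mu]_x `|derive1 f2 x|) / (8 * pi ^+ 3) / xi.
Proof.
move=> x0; have h := cosT_f3E fC fsupp (2 * pi * xi).
have w0 : 0 < 2 * pi * xi by rewrite !mulr_gt0.
have -> : sqhat xi = sinT (derive1 f2) (2 * pi * xi) / (8 * pi ^+ 3) / xi.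
  rewrite sqhatE -[sinT _ _]opprK -h.
  by move: (cosT f2 _) => c; move: (pi : R) p0 => p pp; field; rewrite !gt_eqF.
apply: ler_wpM2r; first by rewrite invr_ge0 ltW.
apply: ler_wpM2r; first by rewrite invr_ge0 mulr_ge0// exprn_ge0// ltW.
by apply: (le_trans (ler_norm _)); apply: sinT_le; exact: L1_f3 fC fsupp.
Qed.

(** The half-integers are the maxima of sin(pi xi)^2, so that this is the
right derivative of the weighted supremum at u0.  Nonnegative half-integers suffice, since
sqhat is even. *)
Definition half_sup : R := sup (range (fun k : nat => sqhat (k%:R + 2^-1))).

Lemma sqhat_le_sup (k : nat) : sqhat (k%:R + 2^-1) <= half_sup.
Proof.
apply: ub_le_sup; last by exists k.
by exists (B / (4 * pi ^+ 2)) => _ [j _ <-]; exact: sqhat_bound.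
Qed.

Lemma half_sup_le c : (forall k : nat, sqhat (k%:R + 2^-1) <= c) -> half_sup <= c.
Proof.
move=> h; apply: ge_sup; first by exists (sqhat (0%:R + 2^-1)); exists 0%N.
by move=> _ [k _ <-].
Qed.

Lemma half_sup_ge0 : 0 <= half_sup.
Proof. exact: le_trans (sqhat_ge0 _) (sqhat_le_sup 0). Qed.

Lemma sq_cosT_u0 xi : xi ^+ 2 * cosT u0 (2 * pi * xi) = sin (pi * xi) ^+ 2 / pi ^+ 2.
Proof.
have := cosT_u0 (2 * pi * xi).
have -> : cos (2 * pi * xi) = 1 - 2 * sin (pi * xi) ^+ 2.
  have -> : 2 * pi * xi = (pi * xi) *+ 2 :> R by rewrite -mulr_natl; ring.
  by rewrite cos_mulr2n cos2sin2; ring.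
move=> h; apply: (@mulfI _ (4 * pi ^+ 2)); first by rewrite mulf_neq0// expf_neq0// gt_eqF.
rewrite [RHS](_ : _ = 4 * sin (pi * xi) ^+ 2); last first.
  by move: (sin _) => c; move: (pi : R) p0 => p pp; field; rewrite gt_eqF.
rewrite mulrA (_ : 4 * pi ^+ 2 * xi ^+ 2 = (2 * pi * xi) ^+ 2); last by ring.
by rewrite h; ring.
Qed.

Let q e x := u0 x + e * f x.
Let qC e x := (q e x)%:C.

Lemma L1_q e : L1 (q e).
Proof. by apply: L1D; [exact: L1_u0|exact: L1Z]. Qed.

Lemma cosT_q e w : cosT (q e) w = cosT u0 w + e * cosT f w.
Proof.
rewrite /cosT -RintegralZl ?L1_cos// -RintegralD//; last 2 first.
- exact/L1_cos/L1_u0.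
- exact/L1Z/L1_cos.
by apply: eq_Rintegral => x _; rewrite /q; ring.
Qed.

Lemma sinT_q e xi : sinT (q e) (2 * pi * xi) = 0.
Proof.
transitivity (sinT u0 (2 * pi * xi) + e * sinT f (2 * pi * xi)); last first.
  by rewrite sinT_u0 sinT_f_eq0 mulr0 addr0.
rewrite /sinT -RintegralZl ?L1_sin// -RintegralD//; last 2 first.
- exact/L1_sin/L1_u0.
- exact/L1Z/L1_sin.
by apply: eq_Rintegral => x _; rewrite /q; ring.
Qed.

Lemma normc_fourier_q e xi : 0 <= e ->
  normc (fourier (qC e) xi) * xi ^+ 2 = sin (pi * xi) ^+ 2 / pi ^+ 2 + e * sqhat xi.
Proof.
move=> e0; have E : cosT (q e) (2 * pi * xi) * xi ^+ 2 =
    sin (pi * xi) ^+ 2 / pi ^+ 2 + e * sqhat xi.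
  by rewrite cosT_q -sq_cosT_u0 /sqhat; ring.
rewrite (fourier_real (L1_q e)) normc_ReIm/= sinT_q oppr0 expr0n addr0 sqrtr_sqr -E.
rewrite -[X in _ * X]ger0_norm ?sqr_ge0// -normrM ger0_norm// E.
by rewrite addr_ge0 ?divr_ge0 ?sqr_ge0// mulr_ge0// sqhat_ge0.
Qed.

(** At distance |y| from a half-integer, the gain in e * sqhat is at most
e L |y|, by the Lipschitz bound, and the loss in sin^2 / pi^2 is at least y^2 / 4;
the net gain is at most (e L)^2. *)
Lemma upper_bound e xi : 0 <= e ->
  sin (pi * xi) ^+ 2 / pi ^+ 2 + e * sqhat xi <=
  1 / pi ^+ 2 + e * half_sup + (B / (2 * pi)) ^+ 2 * e ^+ 2.
Proof.
move=> e0; wlog x0 : xi / 0 <= xi => [H|].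
  have [|x0] := lerP 0 xi; first exact: H.
  have /H : 0 <= - xi by rewrite oppr_ge0 ltW.
  by rewrite sqhatN mulrN sinN sqrrN.
have /andP[k1 k2] := Num.Theory.truncn_itv x0.
set k := Num.truncn xi in k1 k2; pose y := xi - k%:R - 2^-1.
have E : xi = k%:R + 2^-1 + y by rewrite /y; ring.
have y2 : `|y| <= 2^-1.
  by rewrite ler_norml /y; move: k2; rewrite -natr1 => k2; apply/andP; split; lra.
have h1 := sin_sq_near k y2; rewrite -E in h1.
have h2 := sqhat_lip xi (k%:R + 2^-1).
have Ey : xi - (k%:R + 2^-1) = y by rewrite /y; ring.
rewrite Ey in h2; have h3 := sqhat_le_sup k.
set L := B / (2 * pi) in h2 *.
have {}h1 : sin (pi * xi) ^+ 2 / pi ^+ 2 <= 1 / pi ^+ 2 - y ^+ 2 / 4.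
  have -> : 1 / pi ^+ 2 - y ^+ 2 / 4 = (1 - (pi * y) ^+ 2 / 4) / pi ^+ 2.
    by move: (pi : R) p0 => p pp; field; rewrite gt_eqF.
  by apply: ler_wpM2r => //; rewrite invr_ge0 sqr_ge0.
have h4 : e * sqhat xi <= e * half_sup + e * L * `|y|.
  rewrite -mulrA -mulrDr; apply: ler_wpM2l => //.
  by apply: (le_trans h2); rewrite lerD2r.
(* completing the square: e L |y| - y^2 / 4 <= (e L)^2 *)
have h5 : 0 <= (`|y| / 2 - e * L) ^+ 2 by exact: sqr_ge0.
have : y ^+ 2 = `|y| ^+ 2 by rewrite real_normK ?num_real.
by move: h1 h4 h5 => + + + Ey2; rewrite Ey2 !expr2; lra.
Qed.

Lemma lower_bound e (m : R) : 0 <= e ->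
  (forall xi, sin (pi * xi) ^+ 2 / pi ^+ 2 + e * sqhat xi <= m) ->
  1 / pi ^+ 2 + e * half_sup <= m.
Proof.
move=> e0 H.
have hk (k : nat) : 1 / pi ^+ 2 + e * sqhat (k%:R + 2^-1) <= m.
  have := H (k%:R + 2^-1).
  have -> : pi * (k%:R + 2^-1) = pi / 2 + pi *+ k :> R.
    by rewrite -(mulr_natl pi k); ring.
  rewrite (alternatingn (@sinDpi R)) sin_pihalf mulr1 -exprM mulnC exprM sqrrN !expr1n.
  by [].
move: e0; rewrite le_eqVlt => /predU1P[e0|e0].
  by have := hk 0%N; rewrite -e0 !mul0r.
rewrite -lerBrDl -ler_pdivlMl//; apply: half_sup_le => k.
by rewrite ler_pdivlMl// lerBrDl.
Qed.

Lemma cnormy_q e : 0 <= e -> exists2 m : R,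
  cnorm +oo (mulsq (fourier (qC e))) = m%:E &
  1 / pi ^+ 2 + e * half_sup <= m <= 1 / pi ^+ 2 + e * half_sup + (B / (2 * pi)) ^+ 2 * e ^+ 2.
Proof.
move=> e0; have iq := inL1_real (L1_q e).
have ub : (cnorm +oo (mulsq (fourier (qC e))) <=
  (1 / pi ^+ 2 + e * half_sup + (B / (2 * pi)) ^+ 2 * e ^+ 2)%:E)%E.
  apply/(cnorm_fourier_leP iq) => xi; rewrite normc_fourier_q//.
  exact: upper_bound.
have lb : (0 <= cnorm +oo (mulsq (fourier (qC e))))%E by exact: Lnorm_ge0.
move: ub lb (cnorm_fourier_leP iq); rewrite -/(qC e).
case: (cnorm +oo _) => [m||]//; rewrite lee_fin => ub lb /(_ m)[/(_ (lexx _)) h _].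
exists m => //; rewrite ub andbT; apply: lower_bound => // xi.
by rewrite -normc_fourier_q.
Qed.

Let n0 := \int[mu]_x f x.
Let v0 := \int[mu]_x (f x * x ^+ 2).

Lemma L1_sq v : continuous v -> (forall x, 1 < `|x| -> v x = 0) ->
  L1 (fun x => v x * x ^+ 2).
Proof.
move=> cv vout; apply: L1_supp11 => [|x x1]; last by rewrite vout// mul0r.
by apply: contM => //; exact: exprn_continuous.
Qed.

Let f2L : L1 (fun x => f x * x ^+ 2).
Proof. exact: (L1_sq (continuous_f fC) fsupp). Qed.
Let u2L : L1 (fun x => u0 x * x ^+ 2).
Proof. exact: (L1_sq (@continuous_u0 R) (@u0_out R)). Qed.

Lemma J_val : exists2 C : R, 0 < C & forall e, 0 <= e -> e * C <= 1 ->
  exists2 m : R, J f e = (m ^+ 2 * (1 / 6 + e * v0) ^+ 2 / (1 + e * n0) ^+ 4)%:E &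
  1 / pi ^+ 2 + e * half_sup <= m <= 1 / pi ^+ 2 + e * half_sup + (B / (2 * pi)) ^+ 2 * e ^+ 2.
Proof.
have [C C0 fC'] := f_le_tri fC fsupp; exists C => // e e0 eC.
have [m Em mb] := cnormy_q e0; exists m => //.
(* the range of e is chosen so that e |f| <= u0 *)
have q0 x : 0 <= q e x.
  have : `|f x| <= C * u0 x := fC' x.
  rewrite ler_norml => /andP[+ _].
  move=> /(ler_wpM2l e0); rewrite mulrN mulrA.
  have u00 : 0 <= u0 x by exact: tri_ge0.
  have := ler_wpM2r u00 eC; rewrite mul1r /q; lra.
have nq x : normc (qC e x) = q e x.
  by rewrite normc_ReIm/= expr0n addr0 sqrtr_sqr ger0_norm.
have N : cnorm 1 (qC e) = (1 + e * n0)%:E.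
  rewrite (cnorm1E (inL1_real (L1_q e))); congr EFin.
  rewrite -(@Rintegral_u0_1 R) /n0 -RintegralZl// -RintegralD//; last 2 first.
  - exact: L1_u0.
  - exact: L1Z.
  by apply: eq_Rintegral => x _; rewrite nq.
have V : cnorm 1 (mulsq (qC e)) = (1 / 6 + e * v0)%:E.
  rewrite cnorm1_mulsqE -(@Rintegral_u0_sq R) /v0 -RintegralZl// -RintegralD//; last first.
    exact: L1Z.
  rewrite /Rintegral fineK.
    by apply: eq_integral => x _; rewrite nq /q; congr EFin; ring.
  by apply: integrable_fin_num => //; apply: L1D => //; exact: L1Z.
have N1 : 0 < 1 + e * n0.
  by rewrite ltr_wpDr// mulr_ge0// Rintegral_f_ge0.
rewrite /J -/(qC e) /uncertainty Em N V -!EFin_expe -EFinM inver.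
by rewrite expf_eq0/= gt_eqF.
Qed.

(** Subtracting this multiple of u0 makes the odd cosine coefficients of the
difference of constant sign. *)
Let w x := f x - pi ^+ 2 * half_sup * u0 x.

Lemma continuous_w : continuous w.
Proof.
apply: contB; first exact: continuous_f fC.
by apply: contM; [exact: cst_continuous|exact: continuous_u0].
Qed.

Lemma w_out x : 1 < `|x| -> w x = 0.
Proof. by move=> x1; rewrite /w fsupp// u0_out// mulr0 subr0. Qed.

Lemma L1_w : L1 w. Proof. exact: (L1_supp11 (@continuous_w) (@w_out)). Qed.

Lemma cosT_w t : cosT w t = cosT f t - pi ^+ 2 * half_sup * cosT u0 t.
Proof.
rewrite /cosT -RintegralZl; [|exact: measurableT|exact/L1_cos/L1_u0].
rewrite -RintegralB//; [|exact: L1_cos|exact/L1Z/L1_cos/L1_u0].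
by apply: eq_Rintegral => x _; rewrite /w; ring.
Qed.

Lemma cosT_w_even (i : nat) : cosT w (pi * i.+1.*2%:R) = cosT f (pi * i.+1.*2%:R).
Proof.
have -> : pi * i.+1.*2%:R = 2 * pi * i.+1%:R :> R by rewrite -mul2n natrM; ring.
rewrite cosT_w; have := sq_cosT_u0 i.+1%:R.
rewrite mulrC -/(_ * _) [pi * _]mulrC sin_natpi expr0n mul0r => /eqP.
by rewrite mulf_eq0 expf_eq0/= pnatr_eq0 orbF => /eqP ->; rewrite mulr0 subr0.
Qed.

Lemma cosT_w_odd (k : nat) : (k%:R + 2^-1) ^+ 2 * cosT w (pi * k.*2.+1%:R) =
  sqhat (k%:R + 2^-1) - half_sup.
Proof.
have -> : pi * k.*2.+1%:R = 2 * pi * (k%:R + 2^-1) :> R.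
  by rewrite -addn1 natrD -mul2n natrM; field.
rewrite cosT_w mulrBr /sqhat; congr (_ - _).
rewrite mulrCA sq_cosT_u0 (_ : pi * (k%:R + 2^-1) = pi / 2 + pi *+ k); last first.
  by rewrite -(mulr_natl pi k); ring.
rewrite (alternatingn (@sinDpi R)) sin_pihalf mulr1 -exprM mulnC exprM sqrrN !expr1n.
by move: (pi : R) p0 => p pp; field; rewrite gt_eqF.
Qed.

(** The factor (-1)^(j+1) comes from the alternating cosine coefficients of
6 x^2 - 2 on [-1, 1]. *)
Let a (j : nat) : R := (-1) ^+ j.+1 * cosT w (pi * j.+1%:R).

Lemma a_ge0 j : 0 <= a j.
Proof.
rewrite /a; case: (boolP (odd j.+1)) => oj.
  rewrite -(odd_double_half j.+1) oj add1n; set k := j.+1./2.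
  rewrite exprS -mul2n exprM sqrrN expr1n expr1n mulr1 mulN1r mul2n oppr_ge0.
  have k0 : 0 < (k%:R + 2^-1) ^+ 2 :> R by rewrite exprn_gt0// ltr_wpDl// ler0n.
  by rewrite -(pmulr_rle0 _ k0) cosT_w_odd subr_le0 sqhat_le_sup.
have : (0 < j.+1./2)%N by case: j oj.
rewrite -{2 3}(odd_double_half j.+1) (negbTE oj) add0n.
case: (j.+1./2) => // i _.
rewrite cosT_w_even -mul2n exprM sqrrN expr1n expr1n mul1r.
have -> : pi * (2 * i.+1)%:R = 2 * pi * i.+1%:R :> R by rewrite natrM; ring.
exact: cosT_f_ge0.
Qed.

Let I0 := \int[mu]_x (w x * (6 * x ^+ 2 - 2)).

Lemma I0E : I0 = pi ^+ 2 * half_sup + 6 * v0 - 2 * n0.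
Proof.
transitivity (\int[mu]_x (6 * (f x * x ^+ 2) - 2 * f x) -
   \int[mu]_x (pi ^+ 2 * half_sup * (6 * (u0 x * x ^+ 2) - 2 * u0 x))).
  rewrite -RintegralB//.
  - by apply: eq_Rintegral => x _; rewrite /w; ring.
  - by apply: L1B; exact: L1Z.
  - by apply: L1Z; apply: L1B; apply: L1Z => //; exact: L1_u0.
rewrite RintegralZl//; last by apply: L1B; apply: L1Z => //; exact: L1_u0.
rewrite !RintegralB//; try exact: L1Z; last exact/L1Z/L1_u0.
by rewrite !RintegralZl ?Rintegral_u0_1 ?Rintegral_u0_sq// /v0 /n0; [field|exact: L1_u0].
Qed.

(** The shift by 1 moves [-1, 1] to the interval [0, 2] of cos_sum_bern2 and
produces the alternating sign. *)
Lemma cosT_shift (j : nat) : \int[mu]_x (w x * cos (j.+1%:R * (pi * (1 + x)))) = a j.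
Proof.
rewrite /a /cosT -RintegralZl//; last exact/L1_cos/L1_w.
apply: eq_Rintegral => x _.
have -> : j.+1%:R * (pi * (1 + x)) = pi * j.+1%:R * x + pi *+ j.+1 :> R.
  by rewrite -(mulr_natl pi j.+1); ring.
by rewrite (alternatingn (@cosDpi R)); ring.
Qed.

Lemma Rintegral_cos_sum K : \int[mu]_x (w x * cos_sum K (pi * (1 + x))) =
  \sum_(j < K) a j / j.+1%:R ^+ 2.
Proof.
pose F j x := (j.+1%:R ^+ 2)^-1 * (w x * cos (j.+1%:R * (pi * (1 + x)))).
have iw j : L1 (fun x => w x * cos (j.+1%:R * (pi * (1 + x)))).
  apply: L1_supp11 => [|x x1]; last by rewrite w_out// mul0r.
  apply: contM; first exact: continuous_w.
  apply: (cont_comp (@continuous_cos R)).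
  have -> : (fun x => j.+1%:R * (pi * (1 + x))) = (fun x => j.+1%:R * pi + j.+1%:R * pi * x).
    by apply: funext => x; ring.
  by apply: contD; [exact: cst_continuous|exact: mulrl_continuous].
transitivity (\int[mu]_x (\sum_(j < K) F j x)).
  apply: eq_Rintegral => x _; rewrite /cos_sum mulr_sumr.
  by apply: eq_bigr => j _; rewrite /F; ring.
rewrite Rintegral_sum; last by move=> j; apply: L1Z.
by apply: eq_bigr => j _; rewrite /F RintegralZl// cosT_shift mulrC.
Qed.

(** The integral is 24 / pi^2 times the sum of the nonnegative terms a_j / (j+1)^2,
so it dominates each of them. *)
Lemma a_le_I0 (j : nat) : a j / j.+1%:R ^+ 2 <= pi ^+ 2 / 24 * I0.
Proof.
apply: (@ler_add_invn _ _ _ (\int[mu]_x `|w x|)) => M M0.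
pose K := (M + j.+1)%N.
have K0 : (0 < K)%N by rewrite addn_gt0 M0.
have iw := L1_w.
have jK : (j < K)%N by rewrite /K addnS ltnS leq_addl.
have h1 : a j / j.+1%:R ^+ 2 <= \sum_(i < K) a i / i.+1%:R ^+ 2.
  rewrite (bigD1 (Ordinal jK))//= lerDl sumr_ge0// => i _.
  by rewrite divr_ge0 ?sqr_ge0// a_ge0.
apply: (le_trans h1); rewrite -Rintegral_cos_sum.
have cb : continuous (fun x : R => cos_sum K (pi * (1 + x))).
  apply: (cont_comp (f := cos_sum K)).
    exact: (is_derive_continuous (fun x => is_derive_cos_sum K x)).
  by apply: contM; [exact: cst_continuous|
    apply: contD; [exact: cst_continuous|move=> x; exact: cvg_id]].
have iL : L1 (fun x => w x * cos_sum K (pi * (1 + x))).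
  apply: L1_supp11 => [|x x1]; last by rewrite w_out// mul0r.
  by apply: contM; [exact: continuous_w|exact: cb].
have iH : L1 (fun x => pi ^+ 2 / 24 * (w x * (6 * x ^+ 2 - 2))).
  apply: L1Z; apply: L1_supp11 => [|x x1]; last by rewrite w_out// mul0r.
  apply: contM; first exact: continuous_w.
  apply: contB; last exact: cst_continuous.
  by apply: contM; [exact: cst_continuous|exact: exprn_continuous].
have iI : L1 (fun x => w x * (6 * x ^+ 2 - 2)).
  apply: L1_eq (L1Z (24 / pi ^+ 2) iH) => x /=.
  by move: (pi : R) p0 => p pp; field; rewrite gt_eqF.
rewrite -RintegralZl// -[X in _ + X]mulrC -RintegralZl//; last exact: L1_norm.
rewrite -RintegralD//; last exact/L1Z/L1_norm.
apply: le_Rintegral => //.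
  by apply: L1D => //; exact/L1Z/L1_norm.
move=> x _; have [x1|x1] := leP `|x| 1; last first.
  by rewrite w_out// normr0 !mul0r !mulr0 addr0.
have := @cos_sum_bern2 R K (1 + x) K0.
rewrite ler_norml in x1; move: x1 => /andP[xl xr].
have x02 : 0 <= 1 + x <= 2 by apply/andP; split; lra.
move=> /(_ x02) h.
have -> : pi ^+ 2 / 24 * (w x * (6 * x ^+ 2 - 2)) = w x * bern2 (pi * (1 + x)).
  by rewrite /bern2; field.
rewrite -lerBlDl -mulrBr; apply: (le_trans (ler_norm _)).
rewrite normrM mulrC; apply: ler_wpM2r => //.
apply: (le_trans h); rewrite lef_pV2 ?posrE ?ltr0n// ler_nat /K.
exact: leq_addr.
Qed.

(** If all cosine coefficients but the mean vanish, the series kernel of period 2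
sees only the mean of f, whereas for |x| <= 1 - d it is a triangle at x up to
1/K; shrinking the triangle recovers f(x). *)
Lemma f_half_mean : (forall j : nat, cosT f (pi * j.+1%:R) = 0) ->
  forall x, `|x| < 1 -> f x = n0 / 2.
Proof.
move=> ctf0 x x1.
have stf0 (j : nat) : sinT f (pi * j.+1%:R) = 0.
  have -> : pi * j.+1%:R = 2 * pi * (j.+1%:R / 2) :> R by field.
  exact: sinT_f_eq0.
have tri_int d : 0 < d -> d <= 1 - `|x| ->
    \int[mu]_y (f y * triangle d (x - y)) = d ^+ 2 / 2 * n0.
  move=> d0 dx.
  have kerI K : \int[mu]_y (f y * cos_kernel 1 d K (x - y)) = d ^+ 2 / 2 * n0.
    rewrite Rintegral_cos_kernel// mulr1 big1 ?addr0// => j _.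
    by rewrite divr1 Rintegral_cos_sub// ctf0 stf0 !mulr0 addr0 mulr0.
  have it : L1 (fun y => f y * triangle d (x - y)).
    apply: (@L1M_bounded _ _ _ d) => //.
      by apply: continuous_measurable_fun; exact: continuous_tri_sub.
    by move=> y; rewrite ger0_norm ?tri_ge0// tri_le// ltW.
  apply/eqP; rewrite -subr_eq0 -normr_le0.
  apply: (@ler_add_invn _ _ _ (\int[mu]_y `|f y|)) => K K0.
  rewrite add0r -(kerI K) -RintegralB//; last exact: L1_cos_kernel.
  apply: (le_trans (le_normr_Rintegral _ _)) => //.
    by apply: L1B => //; exact: L1_cos_kernel.
  rewrite mulrC -RintegralZl//; last exact: L1_norm.
  apply: le_Rintegral => //.
  - by apply/L1_norm/L1B => //; exact: L1_cos_kernel.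
  - exact/L1Z/L1_norm.
  move=> y _; rewrite -mulrBr normrM mulrC.
  have [y1|y1] := leP `|y| 1; last by rewrite fsupp// normr0 !mulr0.
  apply: ler_wpM2r => //; rewrite distrC -[K%:R^-1]mul1r.
  apply: cos_kernel_err => //; first exact: ltW.
  by apply: (le_trans (ler_normB _ _)); lra.
apply/eqP; rewrite -subr_eq0 -normr_le0; apply/ler_addgt0Pr => e e0.
have ptx : lebesgue_pt f x.
  apply: (@continuous_lebesgue_pt _ _ _ setT) => //.
  - by split => //; exact: openT.
  - exact: integrable_measurable.
  - exact: (continuous_f fC).
have : \forall d \near (0:R)^'+, `|f x - n0 / 2| <= 0 + e.
  near=> d.
  have d0 : 0 < d by [].
  have dx : d <= 1 - `|x|.
    by near: d; apply: nbhs_right_le; rewrite subr_gt0.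
  have : `|\int[mu]_y (f y * triangle d (x - y)) - d ^+ 2 * f x| <= e * d ^+ 2.
    by near: d; exact: tri_average.
  rewrite tri_int// (_ : _ - _ = d ^+ 2 * (n0 / 2 - f x)); last by ring.
  have d2 : 0 < d ^+ 2 by rewrite exprn_gt0.
  by rewrite normrM (ger0_norm (ltW d2)) mulrC ler_pM2r// distrC add0r.
by move=> /filter_ex[].
Unshelve. all: by end_near. Qed.

Lemma slope_gt0 : (exists x, f x != 0) -> 0 < pi ^+ 2 * half_sup + 6 * v0 - 2 * n0.
Proof.
move=> [z fz]; rewrite -I0E ltNge; apply/negP => I00.
have a0 j : a j = 0.
  apply: le_anti; rewrite a_ge0 andbT.
  have := a_le_I0 j; rewrite ler_pdivrMr ?exprn_gt0// => /le_trans; apply.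
  by rewrite mulr_le0_ge0 ?sqr_ge0// mulr_ge0_le0// divr_ge0 ?sqr_ge0.
have ctw0 j : cosT w (pi * j.+1%:R) = 0.
  by have := a0 j; rewrite /a => /eqP; rewrite mulf_eq0 signr_eq0 => /eqP.
have sqhatE_sup (k : nat) : sqhat (k%:R + 2^-1) = half_sup.
  by apply/eqP; rewrite -subr_eq0 -cosT_w_odd ctw0 mulr0.
have sup0 : half_sup = 0.
  apply: le_anti; rewrite half_sup_ge0 andbT.
  (* sqhat is constant on the half-integers and O(1/xi) *)
  pose D := (\int[mu]_x `|derive1 f2 x|) / (8 * pi ^+ 3).
  have D0 : 0 <= D.
    rewrite /D divr_ge0//; first exact: Rintegral_ge0.
    by rewrite mulr_ge0// exprn_ge0// ltW.
  apply: (@ler_add_invn _ _ _ D) => M M0; rewrite add0r -(sqhatE_sup M).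
  have M0' : 0 < M%:R :> R by rewrite ltr0n.
  have M1 : 0 < M%:R + 2^-1 :> R by rewrite addr_gt0.
  apply: (le_trans (sqhat_decay M1)); rewrite -/D; apply: ler_wpM2l => //.
  by rewrite lef_pV2 ?posrE// lerDl.
have ctf0 j : cosT f (pi * j.+1%:R) = 0.
  by have := ctw0 j; rewrite cosT_w sup0 mulr0 mul0r subr0.
have fh := f_half_mean ctf0.
have n00 : n0 / 2 = 0.
  have [C C0 fC'] := f_le_tri fC fsupp.
  apply/eqP; rewrite -normr_le0; apply/ler_addgt0Pr => e e0.
  (* a point so close to 1 that |f x| <= C (1 - x) <= e *)
  pose x := 1 - e / (C + e).
  have Ce : 0 < C + e by rewrite addr_gt0.
  have e1 : 0 < e / (C + e) < 1.
    by rewrite divr_gt0//= ltr_pdivrMr// mul1r ltrDr.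
  have /andP[e2 e3] := e1.
  have x0 : 0 < x by rewrite subr_gt0.
  have x1 : `|x| < 1 by rewrite (gtr0_norm x0) /x gtrBl.
  rewrite -(fh x x1); apply: (le_trans (fC' x)); rewrite tri_in ?(ltW x1)//.
  rewrite (gtr0_norm x0) /x opprB addrC subrK add0r mulrA ler_pdivrMr// mulrC.
  by rewrite ler_pM2l// lerDl ltW.
move/negP: fz; apply; apply/eqP.
have [z1|z1] := ltP `|z| 1; first by rewrite fh.
exact: (f_out fC fsupp).
Qed.

(** Writing the weighted supremum as 1/pi^2 + e m1, where m1 tends to half_sup, the
difference quotient is a polynomial in e and m1 over (1 + e n0)^4. *)
Lemma J_quotient_cvg : (fun e => (fine (J f e) - fine (J f 0)) / e) @ 0^'+ -->
  (pi ^+ 2 * half_sup + 6 * v0 - 2 * n0) / (18 * pi ^+ 4).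
Proof.
have [C C0 HJ] := J_val.
pose c0 : R := 1 / pi ^+ 2; pose D := (B / (2 * pi)) ^+ 2.
have /choice[m hm] : forall e, exists m, 0 <= e -> e * C <= 1 ->
    J f e = (m ^+ 2 * (1 / 6 + e * v0) ^+ 2 / (1 + e * n0) ^+ 4)%:E /\
    c0 + e * half_sup <= m <= c0 + e * half_sup + D * e ^+ 2.
  move=> e; have [e0|e0] := leP 0 e; last by exists 0; lra.
  have [eC|eC] := leP (e * C) 1; last by exists 0; lra.
  by have [m h1 h2] := HJ e e0 eC; exists m.
pose m1 e := (m e - c0) / e.
have nearC : \forall e \near (0:R)^'+, e * C <= 1.
  near=> e; rewrite -ler_pdivlMr// mul1r.
  by near: e; apply: nbhs_right_le; rewrite invr_gt0.
have id0 : (e @[e --> (0:R)^'+] --> (0 : R)).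
  by apply: cvg_at_right_filter; exact: cvg_id.
have m1_cvg : m1 e @[e --> 0^'+] --> half_sup.
  apply: (@squeeze_cvgr _ _ _ _ (cst half_sup) (fun e => half_sup + D * e)).
  - near=> e; have e0 : 0 < e by [].
    have eC : e * C <= 1 by near: e.
    have [_ /andP[h1 h2]] := hm e (ltW e0) eC.
    rewrite /m1 /= ler_pdivlMr// ler_pdivrMr//; apply/andP; split; first by lra.
    by rewrite mulrDl -mulrA -expr2; lra.
  - exact: cvg_cst.
  - rewrite -[X in _ --> X]addr0 -[in X in _ --> X](mulr0 D).
    by apply: cvgD; [exact: cvg_cst|apply: cvgM => //; exact: cvg_cst].
pose q1 e := m1 e / 6 + c0 * v0 + e * (m1 e * v0).
have q1c : q1 e @[e --> 0^'+] --> half_sup / 6 + c0 * v0 + 0 * (half_sup * v0).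
  apply: cvgD; last by apply: cvgM => //; apply: cvgM => //; exact: cvg_cst.
  by apply: cvgD; [apply: cvgM => //; exact: cvg_cst|exact: cvg_cst].
(* (1 + e n0)^4 = 1 + e r(e) *)
pose r e := 4 * n0 + 6 * n0 ^+ 2 * e + 4 * n0 ^+ 3 * e ^+ 2 + n0 ^+ 4 * e ^+ 3.
have cid : continuous (fun e : R => e) by move=> e; exact: cvg_id.
have rc : r e @[e --> 0^'+] --> r 0.
  suff cr : continuous r by apply: cvg_at_right_filter; exact: cr.
  by rewrite /r; do 3 (apply: contD; last by apply: contM;
    [exact: cst_continuous|exact: exprn_continuous || exact: cid]);
    exact: cst_continuous.
have Nc : ((1 + e * n0) ^+ 4)^-1 @[e --> 0^'+] --> ((1 + 0 * n0) ^+ 4)^-1.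
  apply: cvgV; first by rewrite mul0r addr0 expr1n oner_neq0.
  suff cN : continuous (fun e => (1 + e * n0) ^+ 4).
    by apply: cvg_at_right_filter; exact: cN.
  apply: (@cont_comp _ (fun x => x ^+ 4)); first exact: exprn_continuous.
  apply: contD; first exact: cst_continuous.
  by apply: contM; [exact: cid|exact: cst_continuous].
pose T e := (q1 e * (c0 / 3) + e * (q1 e * q1 e) - c0 ^+ 2 / 36 * r e) *
  ((1 + e * n0) ^+ 4)^-1.
have Tc : T e @[e --> 0^'+] --> (pi ^+ 2 * half_sup + 6 * v0 - 2 * n0) / (18 * pi ^+ 4).
  have -> : (pi ^+ 2 * half_sup + 6 * v0 - 2 * n0) / (18 * pi ^+ 4) =
   ((half_sup / 6 + c0 * v0 + 0 * (half_sup * v0)) * (c0 / 3) +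
    0 * ((half_sup / 6 + c0 * v0 + 0 * (half_sup * v0)) *
         (half_sup / 6 + c0 * v0 + 0 * (half_sup * v0))) -
    c0 ^+ 2 / 36 * r 0) * ((1 + 0 * n0) ^+ 4)^-1.
    rewrite /r /c0; move: half_sup v0 n0 (pi : R) p0 => g v n p pp.
    by field; rewrite gt_eqF//= mul0r addr0 oner_neq0.
  apply: cvgM => //; apply: cvgB; last by apply: cvgM => //; exact: cvg_cst.
  apply: cvgD; first by apply: cvgM => //; exact: cvg_cst.
  by apply: cvgM => //; exact: cvgM.
apply: cvg_trans Tc; apply: near_eq_cvg; near=> e.
have e0 : 0 < e by [].
have eC : e * C <= 1 by near: e.
have [-> _] := hm e (ltW e0) eC.
have [|-> /andP[m00 m01]] := hm 0 (lexx _); first by rewrite mul0r.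
have -> : m 0 = c0 by lra.
have N1 : 0 < 1 + e * n0.
  by rewrite ltr_wpDr// mulr_ge0 ?(ltW e0)// Rintegral_f_ge0.
have -> : m e = c0 + e * m1 e by rewrite /m1; field; rewrite gt_eqF.
rewrite /T /q1 /r /=; move: (m1 e) => a1.
by field; rewrite !gt_eqF//= mul0r addr0 ltr01.
Unshelve. all: by end_near. Qed.

End Perturbation.

Theorem theorem7 (R : realType) :
  (exists2 c : R, 0 < c & forall u : R -> R[i], inL1 u ->
     (c%:E * cnorm 1 u ^+ 4 <= uncertainty u)%E)
  /\
  (forall f : R -> R,
     (exists x : R, f x != 0) ->
     (forall x : R, f (- x) = f x) ->
     classC 3 f ->
     (forall x : R, 1 < `|x| -> f x = 0) ->
     (forall xi : R, 0 <= fourier (fun x => (f x)%:C) xi) ->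
     (exists2 d : R, 0 < d &
        forall eps : R, 0 <= eps < d -> J f eps \is a fin_num)
     /\
     (exists2 l : R, 0 < l &
        (fun eps : R => (fine (J f eps) - fine (J f 0)) / eps) @ 0^'+ --> l)).
Proof.
split.
  exists ((64 * 160) ^- 2); last by move=> u; exact: uncertainty_ge.
  by rewrite invr_gt0 exprn_gt0// mulr_gt0.
move=> f f_neq0 _ fC fsupp fpos; split.
  have [C C0 JE] := J_val fC fsupp fpos.
  exists C^-1; first by rewrite invr_gt0.
  move=> e /andP[e0 eC].
  have [|m -> //] := JE e e0.
  by rewrite -ler_pdivlMr// mul1r ltW.
exists ((pi ^+ 2 * half_sup f + 6 * (\int[lebesgue_measure]_x (f x * x ^+ 2)) -
         2 * (\int[lebesgue_measure]_x f x)) / (18 * pi ^+ 4)).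
  apply: divr_gt0; first exact: slope_gt0.
  by rewrite mulr_gt0// exprn_gt0// pi_gt0.
exact: J_quotient_cvg.
Qed.
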